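(* Let $X$ be a complex manifold and let $L$ be a Hermitian holomorphic line bundle over $X$. If the Chern connection of $L$ has positive curvature $F$, then $\omega=\sqrt{-1}\,F$ defines a Kähler metric on $X$, i.e. $g=\omega(\cdot,J\cdot)$ is a Kähler metric on $X$ with fundamental form $\omega$.
   Context: $J$ is the complex structure on $TX$. The Chern connection $\nabla$ of a holomorphic line bundle with Hermitian metric $h$ is the unique connection with $d\,h(s,t)=h(\nabla s,t)+h(s,\nabla t)$ and $\nabla^{0,1}=\bar\partial_L$. Its curvature $F=\nabla^2$ is a 2-form with values in $\mathrm{End}(L)\cong X\times\mathbb{C}$, i.e. an ordinary complex 2-form on $X$; locally, $F=\bar\partial\partial\log h$ where $h$ denotes the positive function representing the metric in a local holomorphic trivialization. The curvature is called positive if $F(v,\bar v)>0$ for every nonzero $v\in T^{1,0}X$. The fundamental form of a Hermitian metric $g$ (a Riemannian metric with $g(Ju,Jv)=g(u,v)$) is $g(J\cdot,\cdot)$, and the metric is Kähler if this form is closed. *)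

(* Defs.v *)
From HB Require Import structures.
From mathcomp Require Import all_boot all_order all_algebra.
From mathcomp Require Import complex.
From mathcomp Require Import all_classical all_reals all_analysis.
Set Implicit Arguments.
Unset Strict Implicit.
Unset Printing Implicit Defensive.
Import Order.TTheory GRing.Theory Num.Theory.
Import numFieldNormedType.Exports.
Local Open Scope classical_set_scope.
Local Open Scope ring_scope.

(* R[i] packed at a type which triggers the generic topology of a
   numFieldType; in its order, 0 < z means that z is real and positive. *)
Definition Cx (R : realType) : numClosedFieldType := complex R.
Arguments Cx : simpl never.

Definition ofR {R : realType} (r : R) : Cx R := real_complex R r.
Definition ReC {R : realType} (z : Cx R) : R := complex.Re z.
Definition ImC {R : realType} (z : Cx R) : R := complex.Im z.
Definition mkC {R : realType} (a b : R) : Cx R := Complex a b.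

Section RealCalculus.
Context {R : realType} {n : nat}.
Implicit Types (f : 'rV[Cx R]_n -> Cx R) (z v : 'rV[Cx R]_n).
Implicit Types (A : set 'rV[Cx R]_n).

(* Derivatives along real lines in C^n; the library's 'D_v on 'rV[Cx R]_n is
   the complex directional derivative, and its [differentiable] is complex
   differentiability. *)
Definition rline f z v (t : R) : Cx R := f (z + ofR t *: v).

Definition rderivable f z v : Prop :=
  derivable (ReC \o rline f z v) 0 1 /\ derivable (ImC \o rline f z v) 0 1.

Definition rderive v f z : Cx R :=
  mkC (derive1 (ReC \o rline f z v) 0) (derive1 (ImC \o rline f z v) 0).

Fixpoint Ck (k : nat) A f : Prop :=
  (forall z, A z -> {for z, continuous f}) /\
  (if k is k'.+1 then
     forall v, (forall z, A z -> rderivable f z v) /\ Ck k' A (rderive v f)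
   else True).

Definition Cinfty A f : Prop := forall k, Ck k A f.

End RealCalculus.

(* Since the transition maps are holomorphic in both directions, the atlas
   determines the holomorphic structure; it need not be maximal. *)
Record complexManifold (R : realType) (n : nat) := ComplexManifold {
  mcarrier :> topologicalType;
  mhausdorff : hausdorff_space mcarrier;
  msecond_countable : @second_countable mcarrier;
  mindex : Type;
  mdom : mindex -> set mcarrier;
  mchart : mindex -> mcarrier -> 'rV[Cx R]_n;
  minv : mindex -> 'rV[Cx R]_n -> mcarrier;
  mdom_open : forall i, open (mdom i);
  mcod_open : forall i, open (mchart i @` mdom i);
  mchartK : forall i x, mdom i x -> minv i (mchart i x) = x;
  mchart_continuous : forall i x, mdom i x -> {for x, continuous (mchart i)};
  minv_continuous :
    forall i z, (mchart i @` mdom i) z -> {for z, continuous (minv i)};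
  mcover : forall x, exists i, mdom i x;
  mtransition_holomorphic : forall i j x, mdom i x -> mdom j x ->
    differentiable (mchart j \o minv i) (mchart i x)
}.

Section Manifold.
Context {R : realType} {n : nat} {X : complexManifold R n}.
Implicit Types (x : X) (W : set X) (i : mindex X) (f : X -> Cx R).

Definition chart_at x : mindex X := sval (cid (mcover x)).

(* The tangent space T_x X is identified with C^n through the chart
   [chart_at x]. It is used as a real vector space, real scalars acting
   through [ofR], with complex structure [cplxJ]. *)
Definition tangent x : lmodType (Cx R) := 'rV[Cx R]_n.

Definition cplxJ {x} (v : tangent x) : tangent x := 'i *: v.

(* The coordinate vector field of the chart i with constant components u. *)
Definition coordvec i (u : 'rV[Cx R]_n) x : tangent x :=
  'd (mchart (chart_at x) \o minv i) (mchart i x) u.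

Definition smooth_on W f : Prop :=
  forall i, Cinfty (mchart i @` (W `&` mdom i)) (f \o minv i).

Definition holomorphic_on W f : Prop :=
  forall i x, W x -> mdom i x -> differentiable (f \o minv i) (mchart i x).

(* df(v), for a real tangent vector v *)
Definition dfun f x (v : tangent x) : Cx R :=
  rderive v (f \o minv (chart_at x)) (mchart (chart_at x) x).

Definition dbar f x (v : tangent x) : Cx R :=
  2^-1 * (dfun f v + 'i * dfun f (cplxJ v)).

Definition real_linear x (V : lmodType (Cx R)) (a : tangent x -> V) : Prop :=
  (forall u v, a (u + v) = a u + a v) /\
  (forall (r : R) u, a (ofR r *: u) = ofR r *: a u).

Definition tensor2 := forall x, tangent x -> tangent x -> Cx R.

Definition smooth_tensor2 (b : tensor2) : Prop :=
  forall i u v,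
    smooth_on (mdom i) (fun x => b x (coordvec i u x) (coordvec i v x)).

(* d b (u, v, w) on coordinate fields of the chart i, for a 2-form b *)
Definition dform2 (b : tensor2) i x (u v w : 'rV[Cx R]_n) : Cx R :=
  let c (v w z : 'rV[Cx R]_n) :=
    b (minv i z) (coordvec i v (minv i z)) (coordvec i w (minv i z)) in
  rderive u (c v w) (mchart i x) - rderive v (c u w) (mchart i x)
  + rderive w (c u v) (mchart i x).

Definition closed2 (b : tensor2) : Prop :=
  forall i x u v w, mdom i x -> dform2 b i x u v w = 0.

(* The complexified tangent space T_x X (x) C: the pair (a, b) stands for
   a + sqrt(-1) b, where this sqrt(-1) is that of the factor C and not J. *)
Definition tangentC x : zmodType := (tangent x * tangent x)%type.

Definition conjT {x} (v : tangentC x) : tangentC x := (v.1, - v.2).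

(* J v = sqrt(-1) v *)
Definition T10 {x} (v : tangentC x) : Prop :=
  cplxJ v.1 = - v.2 /\ cplxJ v.2 = v.1.

Definition extC (b : tensor2) x (v w : tangentC x) : Cx R :=
  (b x v.1 w.1 - b x v.2 w.2) + 'i * (b x v.1 w.2 + b x v.2 w.1).

Definition positive_form (F : tensor2) : Prop :=
  forall x (v : tangentC x), T10 v -> v <> 0 -> 0 < extC F v (conjT v).

Definition real_tensor2 := forall x, tangent x -> tangent x -> R.

Definition riemannian (g : real_tensor2) : Prop :=
  [/\ forall x (v u1 u2 : tangent x), g x (u1 + u2) v = g x u1 v + g x u2 v,
      forall x (r : R) (u v : tangent x), g x (ofR r *: u) v = r * g x u v,
      forall x (u v : tangent x), g x u v = g x v u,
      forall x (u : tangent x), u <> 0 -> 0 < g x u u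
    & smooth_tensor2 (fun x u v => ofR (g x u v))].

Definition hermitian (g : real_tensor2) : Prop :=
  riemannian g /\
  forall x (u v : tangent x), g x (cplxJ u) (cplxJ v) = g x u v.

Definition fundamental_form (g : real_tensor2) : tensor2 :=
  fun x u v => ofR (g x (cplxJ u) v).

Definition kahler (g : real_tensor2) : Prop :=
  hermitian g /\ closed2 (fundamental_form g).

End Manifold.

Arguments tensor2 {R n} X.
Arguments real_tensor2 {R n} X.

(* [lframe j] is a holomorphic frame over the open set [ldom j], and
   [lcoef j] gives the coordinate of a vector in this frame. *)
Record holLineBundle (R : realType) (n : nat) (X : complexManifold R n) :=
  HolLineBundle {
  lfib :> X -> lmodType (Cx R);
  lindex : Type;
  ldom : lindex -> set X;
  lframe : forall (j : lindex) (x : X), lfib x;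
  lcoef : forall (j : lindex) (x : X), lfib x -> Cx R;
  ldom_open : forall j, open (ldom j);
  lcover : forall x, exists j, ldom j x;
  lcoefK : forall j x (l : lfib x), ldom j x -> lcoef j l *: lframe j x = l;
  lframeK : forall j x (c : Cx R), ldom j x -> lcoef j (c *: lframe j x) = c;
  ltransition_holomorphic : forall j k,
    holomorphic_on (ldom j `&` ldom k) (fun x => lcoef j (lframe k x))
}.

Section LineBundle.
Context {R : realType} {n : nat} {X : complexManifold R n}.
Variable (L : holLineBundle X).

Definition section := forall x : X, L x.

(* 1-forms with values in L *)
Definition lform1 := forall x : X, tangent x -> L x.

Definition smooth_section (W : set X) (s : section) : Prop :=
  forall j, smooth_on (W `&` ldom j) (fun x => lcoef j (s x)).

Definition smooth_lform1 (W : set X) (a : lform1) : Prop :=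
  (forall x, W x -> real_linear (a x)) /\
  (forall i u, smooth_section (W `&` mdom i) (fun x => a x (coordvec i u x))).

Definition triv_at (x : X) : lindex L := sval (cid (lcover L x)).

Definition dbarL (s : section) : lform1 := fun x v =>
  dbar (fun y => lcoef (triv_at x) (s y)) v *: lframe (triv_at x) x.

Definition part01 (a : lform1) : lform1 := fun x v =>
  2^-1 *: (a x v + 'i *: a x (cplxJ v)).

Record hermitianMetric := HermitianMetric {
  hmet :> forall x : X, L x -> L x -> Cx R;
  hmet_linear : forall x (c : Cx R) (s s' t : L x),
    hmet (c *: s + s') t = c * hmet s t + hmet s' t;
  hmet_conj : forall x (s t : L x), hmet t s = (hmet s t)^*;
  hmet_pos : forall x (s : L x), s <> 0 -> 0 < hmet s s;
  hmet_smooth : forall j,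
    smooth_on (ldom j) (fun x => hmet (lframe j x) (lframe j x))
}.

(* A connection is a morphism of sheaves from smooth sections of L to smooth
   1-forms with values in L. Such a morphism amounts to an operator on germs,
   so [nabla s x] is meaningful for s smooth near x only; outside of the open
   sets where it is assumed smooth, a section is an arbitrary function. *)
Record connection := Connection {
  nabla :> section -> lform1;
  nabla_local : forall (W : set X) (s t : section), open W ->
    smooth_section W s -> (forall x, W x -> s x = t x) ->
    forall x (v : tangent x), W x -> nabla s v = nabla t v;
  nabla_smooth : forall (W : set X) (s : section), open W ->
    smooth_section W s -> smooth_lform1 W (nabla s);
  nabla_linear : forall (W : set X) (c : Cx R) (s t : section), open W ->
    smooth_section W s -> smooth_section W t ->
    forall x (v : tangent x), W x ->
      nabla (fun y => c *: s y + t y) v = c *: nabla s v + nabla t v;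
  nabla_leibniz : forall (W : set X) (f : X -> Cx R) (s : section), open W ->
    smooth_on W f -> smooth_section W s ->
    forall x (v : tangent x), W x ->
      nabla (fun y => f y *: s y) v = dfun f v *: s x + f x *: nabla s v
}.

Definition is_chern (h : hermitianMetric) (D : connection) : Prop :=
  (forall (W : set X) (s t : section), open W ->
     smooth_section W s -> smooth_section W t ->
     forall x (v : tangent x), W x ->
       dfun (fun y => h y (s y) (t y)) v
       = h x (D s x v) (t x) + h x (s x) (D t x v)) /\
  (forall (W : set X) (s : section), open W -> smooth_section W s ->
     forall x (v : tangent x), W x -> part01 (D s) v = dbarL s v).

(* The extension of D to 1-forms a with values in L, evaluated on coordinate
   fields U, V of the chart i:
     (D a)(U, V) = D_U (a V) - D_V (a U) - a [U, V], where [U, V] = 0. *)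
Definition ext_connection (D : connection) (a : lform1)
    (i : mindex X) (x : X) (u v : 'rV[Cx R]_n) : L x :=
  D (fun y => a y (coordvec i v y)) x (coordvec i u x)
  - D (fun y => a y (coordvec i u y)) x (coordvec i v x).

(* D^2 s = F s for all local smooth sections s. As local frames exist and
   coordinate fields span the tangent spaces, this determines F. *)
Definition is_curvature (D : connection) (F : tensor2 X) : Prop :=
  forall (W : set X) (s : section), open W -> smooth_section W s ->
  forall i x (u v : 'rV[Cx R]_n), W x -> mdom i x ->
    ext_connection D (D s) i x u v
    = F x (coordvec i u x) (coordvec i v x) *: s x.

End LineBundle.

(* Main.v *)
(* A local holomorphic frame e is smooth: the transition function f between two
   frames satisfies |f|^2 = a / b with a, b the squared norms of the frames, and,
   f being holomorphic, its logarithmic derivative along v is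
   (a_v - i a_{Jv}) / 2a - (b_v - i b_{Jv}) / 2b; smoothness of f follows by
   bootstrapping from this equation, without Cauchy's integral formula.

   Write D e = theta e. As e is holomorphic, theta(Jv) = i theta(v), which makes
   the (0,2)-part of F vanish. Applying the metric compatibility of D twice to
   h(e, e) and using that coordinate derivatives commute gives
   F + conj F = 0. The two facts together give F(Ju, Jv) = F(u, v), so that
   g = i F(., J.) is a real symmetric J-invariant tensor. Closedness is
   d(d theta) = 0. *)
Require Import Defs.
From mathcomp Require Import all_boot all_order all_algebra.
From mathcomp Require Import complex.
From mathcomp Require Import all_classical all_reals all_analysis.
From mathcomp Require Import ring lra.
Import Order.TTheory GRing.Theory Num.Theory.
Import numFieldNormedType.Exports.
Local Open Scope classical_set_scope.
Local Open Scope ring_scope.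

Set Implicit Arguments.
Unset Strict Implicit.
Unset Printing Implicit Defensive.

(** * Derivatives along real lines in complex normed spaces *)

Section RealLines.
Context {R : realType} {V : normedModType (Cx R)}.
Implicit Types (p q u v w z : V) (r s t : R).

Lemma ofRD r s : ofR (r + s) = ofR r + ofR s.
Proof. exact: (rmorphD (real_complex R)). Qed.

Lemma ofR0 : ofR (0 : R) = 0.
Proof. by []. Qed.

Lemma ofRN r : ofR (- r) = - ofR r.
Proof. exact: (rmorphN (real_complex R)). Qed.

Lemma normC_ofR r : `|ofR r| = ofR `|r|.
Proof.
rewrite /ofR [LHS](normc_def (real_complex R r)) /=.
by rewrite expr0n /= addr0 sqrtr_sqr.
Qed.

Lemma ofR_ge0 (c : Cx R) : 0 <= c -> ofR (ReC c) = c.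
Proof. by move=> /ger0_real; exact: (@RRe_real R). Qed.

Lemma ofR_lt r s : (ofR r < ofR s) = (r < s).
Proof. exact: (@ltcR R). Qed.

Lemma ofR_le r s : (ofR r <= ofR s) = (r <= s).
Proof. exact: (@lecR R). Qed.

(** Norms over [Cx R] take values in [Cx R]; the real part turns norm estimates into inequalities
    between real numbers. *)
Definition rnorm v : R := ReC `|v|.

Lemma ofR_rnorm v : ofR (rnorm v) = `|v|.
Proof. by rewrite /rnorm ofR_ge0. Qed.

Lemma rnorm_ge0 v : 0 <= rnorm v.
Proof. by rewrite -ofR_le ofR_rnorm ofR0. Qed.

Lemma rnormD u v : rnorm (u + v) <= rnorm u + rnorm v.
Proof. by rewrite -ofR_le ofRD !ofR_rnorm ler_normD. Qed.

Lemma rnormZ r v : rnorm (ofR r *: v) = `|r| * rnorm v.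
Proof.
apply: (@complexI R); rewrite [RHS](rmorphM (real_complex R)).
have := ofR_rnorm (ofR r *: v); rewrite /ofR => ->.
by rewrite normrZ normC_ofR -ofR_rnorm.
Qed.

Lemma rnorm0 : rnorm (0 : V) = 0.
Proof. by rewrite /rnorm normr0. Qed.

Lemma nbhs_rnorm z (A : set V) :
  nbhs z A <-> exists2 d : R, 0 < d & forall p, rnorm (p - z) < d -> A p.
Proof.
split=> [/nbhs_normP [e /= e0 eA]|[d d0 dA]].
  exists (ReC e); first by rewrite -ofR_lt ofR_ge0 ?ltW.
  move=> p pz; apply: eA => /=.
  by rewrite distrC -ofR_rnorm -(ofR_ge0 (ltW e0)) ofR_lt.
apply/nbhs_normP; exists (ofR d) => /=; first by rewrite -ofR0 ofR_lt.
by move=> p /= pz; apply: dA; rewrite -ofR_lt ofR_rnorm distrC.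
Qed.

(** Stated for real-valued functions, so that the mean value theorem applies; complex functions
    enter through their real and imaginary parts. *)
Definition is_dl (phi : V -> R) z v (c : R) : Prop :=
  is_derive (0 : R) (1 : R) (fun t : R => phi (z + ofR t *: v)) c.

Lemma is_derive_shifted (f : R -> R) (t0 c : R) :
  is_derive (0 : R) (1 : R) (fun t => f (t + t0)) c ->
  is_derive t0 (1 : R) f c.
Proof.
move=> df.
have -> : f = (fun t => f (t + t0)) \o (shift (- t0)).
  by apply/funext => t /=; rewrite subrK.
rewrite -[c]mulr1; apply: is_derive1_comp; first by rewrite /= subrr.
exact: is_derive_shift.
Qed.

Lemma is_dl_derive (phi : V -> R) z v t0 c :
  is_dl phi (z + ofR t0 *: v) v c ->
  is_derive t0 (1 : R) (fun t => phi (z + ofR t *: v)) c.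
Proof.
move=> H; apply: is_derive_shifted; move: H; rewrite /is_dl.
by under [X in is_derive _ _ X _ -> _]eq_fun => t do
  rewrite -addrA -scalerDl -ofRD [t0 + t]addrC.
Qed.

(** The one-variable mean value theorem on the segment between 0 and [s]. Here [s] may be negative,
    as the real coordinates of an increment can be; bounding [t] by [s] in absolute value covers
    both signs. *)
Lemma mvt_line (phi D : V -> R) z v (s : R) :
  (forall t, `|t| <= `|s| ->
     is_dl phi (z + ofR t *: v) v (D (z + ofR t *: v))) ->
  exists2 t, `|t| <= `|s| &
    phi (z + ofR s *: v) - phi z = s * D (z + ofR t *: v).
Proof.
move=> dphi.
pose f t := phi (z + ofR t *: v).
have df t : `|t| <= `|s| -> is_derive t (1 : R) f (D (z + ofR t *: v)).
  by move=> /dphi /is_dl_derive.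
have cf a b : (forall t, t \in `[a, b]%R -> `|t| <= `|s|) ->
    {within `[a, b], continuous f}.
  move=> ab; apply: derivable_within_continuous => t tab.
  by have [] := df t (ab t tab).
have f0 : f 0 = phi z by rewrite /f ofR0 scale0r addr0.
have [s0|s0] := leP 0 s.
  have ab t : t \in `[0, s]%R -> `|t| <= `|s|.
    by rewrite in_itv /= => /andP[t0 ts]; rewrite !ger0_norm.
  have [|c cab e] := @MVT_segment R f (fun t => D (z + ofR t *: v)) 0 s s0 _
    (cf _ _ ab).
    move=> t tab; apply/df/ab; move: tab; rewrite !in_itv /=.
    by move=> /andP[/ltW -> /ltW ->].
  by exists c; [exact: ab|rewrite -f0 -/(f s) e subr0 mulrC].
have ab t : t \in `[s, 0]%R -> `|t| <= `|s|.
  rewrite in_itv /= => /andP[t0 ts].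
  by rewrite !ler0_norm ?lerN2 // ltW.
have [|c cab e] := @MVT_segment R f (fun t => D (z + ofR t *: v)) s 0 (ltW s0) _
  (cf _ _ ab).
  move=> t tab; apply/df/ab; move: tab; rewrite !in_itv /=.
  by move=> /andP[/ltW -> /ltW ->].
exists c; first exact: ab.
by rewrite -f0 -/(f s) -opprB e sub0r mulrN opprK mulrC.
Qed.

Lemma is_dlB (f g : V -> R) z v a b :
  is_dl f z v a -> is_dl g z v b -> is_dl (fun p => f p - g p) z v (a - b).
Proof. by move=> df dg; apply: is_deriveB. Qed.

Lemma continuous_rnorm (phi : V -> R) z (e : R) :
  {for z, continuous phi} -> 0 < e ->
  exists2 d : R, 0 < d & forall p, rnorm (p - z) < d -> `|phi p - phi z| < e.
Proof.
move=> /cvgrPdist_lt /(_ e) H e0; have /nbhs_rnorm [d d0 dH] := H e0.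
by exists d => // p /dH /=; rewrite distrC.
Qed.

(** The second difference of [phi] over the parallelogram with sides [s u] and [s v] is [s * s]
    times a value of [Duv], and also [s * s] times a value of [Dvu], both taken near [z]. Continuity
    at [z] then bounds the difference of the two derivatives by any [e]. *)
Lemma schwarz (A : set V) (phi Du Dv Duv Dvu : V -> R) u v z :
  nbhs z A ->
  (forall p, A p -> [/\ is_dl phi p u (Du p), is_dl phi p v (Dv p),
    is_dl Du p v (Duv p) & is_dl Dv p u (Dvu p)]) ->
  {for z, continuous Duv} -> {for z, continuous Dvu} -> Duv z = Dvu z.
Proof.
move=> /nbhs_rnorm [d0 d00 dA] dphi cuv cvu.
apply/eqP; rewrite -subr_eq0 -normr_eq0; apply/eqP/le_anti.
rewrite normr_ge0 andbT; apply/ler_addgt0Pl => e e0; rewrite addr0.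
have e20 : 0 < e / 2 by rewrite divr_gt0.
have [d1 d10 H1] := continuous_rnorm cuv e20.
have [d2 d20 H2] := continuous_rnorm cvu e20.
pose d := Num.min d0 (Num.min d1 d2).
have d_gt0 : 0 < d by rewrite !lt_min d00 d10 d20.
(* This scale keeps the whole parallelogram within distance [d] of [z]; the summand 1 makes the
   denominator positive and the bound strict. *)
pose s := d / (1 + rnorm u + rnorm v).
have M0 : 0 < 1 + rnorm u + rnorm v.
  by rewrite -addrA ltr_pwDl ?addr_ge0 ?rnorm_ge0.
have s0 : 0 < s by rewrite divr_gt0.
have small a b : `|a| <= `|s| -> `|b| <= `|s| ->
    rnorm (z + ofR a *: u + ofR b *: v - z) < d.
  rewrite (gtr0_norm s0) => ha hb.
  have -> : z + ofR a *: u + ofR b *: v - z = ofR a *: u + ofR b *: v.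
    by rewrite -!addrA addrC -!addrA addNr addr0.
  apply: le_lt_trans (rnormD _ _) _; rewrite !rnormZ.
  apply: (@le_lt_trans _ _ (s * rnorm u + s * rnorm v)).
    by apply: lerD; apply: ler_wpM2r => //; exact: rnorm_ge0.
  rewrite -[ltRHS](divfK (lt0r_neq0 M0)) -/s -mulrDr ltr_pM2l //.
  by rewrite -addrA ltrDr.
have sA a b : `|a| <= `|s| -> `|b| <= `|s| ->
    A (z + ofR a *: u + ofR b *: v).
  by move=> ha hb; apply: dA; apply: lt_le_trans (small _ _ ha hb) _;
    rewrite ge_min lexx.
have z0 : `|0 : R| <= `|s| by rewrite normr0.
pose q := phi (z + ofR s *: u + ofR s *: v) - phi (z + ofR s *: u)
  - (phi (z + ofR s *: v) - phi z).
(* The increment in direction [v] is a function along [u] with derivative an increment of [Du]; a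
   second use of the mean value theorem along [v] produces [Duv]. *)
have [a [b [ha hb Eab]]] : exists a b, [/\ `|a| <= `|s|, `|b| <= `|s| &
    q = s * s * Duv (z + ofR a *: u + ofR b *: v)].
  have [|a ha Ea] := @mvt_line (fun p => phi (p + ofR s *: v) - phi p)
    (fun p => Du (p + ofR s *: v) - Du p) z u s.
    move=> t ht; apply: is_dlB; last first.
      by have := sA t 0 ht z0; rewrite ofR0 scale0r addr0 => /dphi[].
    have [+ _ _ _] := dphi _ (sA t s ht (lexx _)).
    by rewrite /is_dl; under eq_fun do rewrite [_ + ofR s *: v + _]addrAC.
  have [|b hb Eb] := @mvt_line Du Duv (z + ofR a *: u) v s.
    by move=> t ht; have [] := dphi _ (sA a t ha ht).
  by exists a, b; split; rewrite // -mulrA -Eb -Ea.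
(* The same [q], with the roles of [u] and [v] exchanged. *)
have [a' [b' [ha' hb' Eab']]] : exists a b, [/\ `|a| <= `|s|, `|b| <= `|s| &
    q = s * s * Dvu (z + ofR a *: u + ofR b *: v)].
  have [|b' hb' Eb] := @mvt_line (fun p => phi (p + ofR s *: u) - phi p)
    (fun p => Dv (p + ofR s *: u) - Dv p) z v s.
    move=> t ht; apply: is_dlB; last first.
      by have := sA 0 t z0 ht; rewrite ofR0 scale0r addr0 => /dphi[].
    have [_ + _ _] := dphi _ (sA s t (lexx _) ht).
    rewrite /is_dl addrAC.
    by under eq_fun do rewrite [_ + ofR s *: u + _]addrAC.
  have [|a' ha' Ea] := @mvt_line Dv Dvu (z + ofR b' *: v) u s.
    by move=> t ht; rewrite addrAC; have [] := dphi _ (sA t b' ht hb').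
  exists a', b'; split => //.
  have -> : z + ofR a' *: u + ofR b' *: v = z + ofR b' *: v + ofR a' *: u.
    by rewrite addrAC.
  rewrite -mulrA -Ea -Eb /q.
  have -> : z + ofR s *: v + ofR s *: u = z + ofR s *: u + ofR s *: v.
    by rewrite addrAC.
  by ring.
have E : Duv (z + ofR a *: u + ofR b *: v) = Dvu (z + ofR a' *: u + ofR b' *: v).
  apply: (mulfI (x := s * s)); first by rewrite mulf_neq0 // gt_eqF.
  by rewrite -Eab.
have N1 : `|Duv (z + ofR a *: u + ofR b *: v) - Duv z| < e / 2.
  by apply/H1/(lt_le_trans (small _ _ ha hb)); rewrite !ge_min lexx orbT.
have N2 : `|Dvu (z + ofR a' *: u + ofR b' *: v) - Dvu z| < e / 2.
  by apply/H2/(lt_le_trans (small _ _ ha' hb')); rewrite !ge_min lexx !orbT.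
rewrite (_ : Duv z - Dvu z = (Dvu (z + ofR a' *: u + ofR b' *: v) - Dvu z)
  - (Duv (z + ofR a *: u + ofR b *: v) - Duv z)); last by rewrite E; ring.
by apply: le_trans (ler_normB _ _) _; rewrite [leRHS]splitr lerD // ltW.
Qed.

End RealLines.

(** * Chain rule along curves, from continuous partial derivatives *)

Section ChainRule.
Context {R : realType} {V : normedModType (Cx R)}.
Implicit Types (p q u v w z : V) (r s t : R).

(** Multiplying the difference quotient by [t] removes the punctured neighbourhood: the estimate is
    trivial at 0, so it can be combined with other estimates on full neighbourhoods. *)
Lemma is_derive0P (f : R -> R) (c : R) :
  is_derive (0 : R) (1 : R) f c <->
  (forall e : R, 0 < e ->
    \forall t \near (0 : R), `|f t - f 0 - t * c| <= e * `|t|).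
Proof.
have E t : t != 0 -> `|c - t^-1 *: (f (t *: (1 : R) + 0) - f 0)| =
    `|f t - f 0 - t * c| / `|t|.
  move=> t0; rewrite -normfV -normrM distrC; congr `|_|.
  rewrite addr0 [t *: _]mulr1 /GRing.scale /= mulrBl [t * c]mulrC mulfK //.
  by rewrite mulrC.
split=> [[df dv] e e0|H].
  have : h^-1 *: (f (h *: (1 : R) + 0) - f 0) @[h --> (0 : R)^'] --> c.
    by rewrite -dv; exact: df.
  move=> /cvgrPdist_le /(_ e e0) /= H.
  have {}H : \forall t \near (0 : R), t != 0 ->
    `|c - t^-1 *: (f (t *: (1 : R) + 0) - f 0)| <= e by exact: H.
  near=> t; have [->|t0] := eqVneq t 0.
    by rewrite !mul0r subrr subr0 !normr0 mulr0.
  rewrite -ler_pdivrMr ?normr_gt0 // -E //.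
  by move: t0; near: t.
have C : h^-1 *: (f (h *: (1 : R) + 0) - f 0) @[h --> (0 : R)^'] --> c.
  apply/cvgrPdist_le => e e0.
  have {}H := H e e0.
  suff : \forall t \near (0 : R), t != 0 ->
    `|c - t^-1 *: (f (t *: (1 : R) + 0) - f 0)| <= e by [].
  near=> t => t0; rewrite E // ler_pdivrMr ?normr_gt0 //.
  by near: t.
by apply: DeriveDef; [apply/cvg_ex; exists c|exact: cvg_lim C].
Unshelve. all: by end_near. Qed.

Variables (I : finType) (b : I -> V) (phi : V -> R) (B : I -> V -> R).
Variables (A : set V) (z : V).
Hypothesis Az : nbhs z A.
Hypothesis dphi : forall m p, A p -> is_dl phi p (b m) (B m p).
Hypothesis cB : forall m, {for z, continuous (B m)}.

(** The increment telescopes into moves along one direction [b m] at a time; each move is a value of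
    [B m] at a point near [z], hence close to [B m z]. The base point [p] is kept free because the
    induction shifts it. *)
Lemma partial_increment (l : seq I) (e : R) : 0 < e ->
  exists2 d : R, 0 < d & forall p (c : I -> R), rnorm (p - z) < d ->
    (forall m, `|c m| < d) ->
    `|phi (p + \sum_(m <- l) ofR (c m) *: b m) - phi p
      - \sum_(m <- l) c m * B m z| <= e * \sum_(m <- l) `|c m|.
Proof.
move=> e0; elim: l => [|m l [d' d'0 IH]].
  exists 1 => // p c _ _; rewrite !big_nil addr0 mulr0 subrr subr0 normr0.
  by rewrite lexx.
have /nbhs_rnorm [d1 d10 dA] := Az.
have [d2 d20 dB] := continuous_rnorm (@cB m) e0.
have M0 : 0 < 1 + rnorm (b m) by rewrite ltr_pwDl ?rnorm_ge0.
pose d3 := Num.min d' (Num.min d1 d2).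
have d30 : 0 < d3 by rewrite !lt_min d'0 d10 d20.
(* Leaves room for [p] and for one move along [b m] inside the ball of radius [d3]. *)
pose d := d3 / (1 + rnorm (b m)).
have d0 : 0 < d by rewrite divr_gt0.
exists d => // p c pz cd.
have near_z t : `|t| <= `|c m| -> rnorm (p + ofR t *: b m - z) < d3.
  move=> tc; rewrite addrAC; apply: le_lt_trans (rnormD _ _) _.
  rewrite rnormZ -[ltRHS](divfK (lt0r_neq0 M0)) -/d mulrDr mulr1.
  rewrite ltr_leD // ler_wpM2r ?rnorm_ge0 //.
  exact/(le_trans tc)/ltW.
have [t tc Et] : exists2 t, `|t| <= `|c m| &
    phi (p + ofR (c m) *: b m) - phi p = c m * B m (p + ofR t *: b m).
  apply: mvt_line => t tc; apply/dphi/dA.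
  by apply: lt_le_trans (near_z _ tc) _; rewrite !ge_min lexx orbT.
have {}IH : `|phi (p + ofR (c m) *: b m + \sum_(m <- l) ofR (c m) *: b m)
      - phi (p + ofR (c m) *: b m)
      - \sum_(m <- l) c m * B m z| <= e * \sum_(m <- l) `|c m|.
  apply: IH => [|m'].
    by apply: lt_le_trans (near_z _ (lexx _)) _; rewrite !ge_min lexx.
  apply: lt_le_trans (cd m') _.
  apply: (@le_trans _ _ d3); last by rewrite !ge_min lexx.
  by rewrite ler_pdivrMr // ler_peMr ?lerDl ?rnorm_ge0 // ltW.
rewrite !big_cons addrA.
set S1 := phi _ in IH *; set S2 := \sum_(m <- l) _ in IH *.
have -> : S1 - phi p - (c m * B m z + S2) =
    (S1 - phi (p + ofR (c m) *: b m) - S2)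
    + c m * (B m (p + ofR t *: b m) - B m z).
  by rewrite mulrBr -Et; ring.
apply: le_trans (ler_normD _ _) _.
rewrite [leRHS]mulrDr [leLHS]addrC lerD // normrM mulrC ler_wpM2r //.
apply/ltW/dB/(lt_le_trans (near_z _ tc)).
by rewrite !ge_min lexx !orbT.
Qed.

(** Two errors are added: that of [partial_increment], small relative to the sum of the coordinates,
    and that of replacing each [c m t] by [t * c' m]. *)
Lemma is_derive_curve (g : R -> V) (c : I -> R -> R) (c' : I -> R) :
  g 0 = z ->
  (\forall t \near (0 : R), g t = z + \sum_m ofR (c m t) *: b m) ->
  (forall m, c m 0 = 0) ->
  (forall m, is_derive (0 : R) (1 : R) (c m) (c' m)) ->
  is_derive (0 : R) (1 : R) (phi \o g) (\sum_m c' m * B m z).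
Proof.
move=> g0 gE c0 dc; apply/is_derive0P => e e0.
(* [M1] bounds the growth of the coordinates [c m] relative to [t], and [M2] the derivatives
   [B m z]; dividing by them gives each of the two errors the share [e / 2]. *)
pose M1 := 1 + \sum_m (`|c' m| + 1).
pose M2 := 1 + \sum_m `|B m z|.
have M10 : 0 < M1 by rewrite ltr_pwDl ?sumr_ge0 // => m _; rewrite addr_ge0.
have M20 : 0 < M2 by rewrite ltr_pwDl ?sumr_ge0.
have e10 : 0 < e / 2 / M1 by rewrite !divr_gt0.
have e20 : 0 < e / 2 / M2 by rewrite !divr_gt0.
have [d d0 dH] := partial_increment (index_enum I) e10.
have c1 : \forall t \near (0 : R), forall m, `|c m t| <= (`|c' m| + 1) * `|t|.
  refine (@filter_forall _ _
    (fun m t => `|c m t| <= (`|c' m| + 1) * `|t|) (nbhs (0 : R)) _ _) => m.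
  have /is_derive0P /(_ 1 ltr01) H := dc m.
  near=> t.
  have h : `|c m t - c m 0 - t * c' m| <= 1 * `|t| by near: t.
  rewrite c0 subr0 mul1r in h.
  rewrite -[c m t](subrK (t * c' m)); apply: le_trans (ler_normD _ _) _.
  by rewrite [leRHS]mulrDl mul1r [leRHS]addrC lerD // normrM mulrC.
have c2 : \forall t \near (0 : R), forall m,
    `|c m t - t * c' m| <= e / 2 / M2 * `|t|.
  refine (@filter_forall _ _ (fun m t =>
    `|c m t - t * c' m| <= e / 2 / M2 * `|t|) (nbhs (0 : R)) _ _) => m.
  have /is_derive0P /(_ _ e20) H := dc m.
  near=> t.
  have h : `|c m t - c m 0 - t * c' m| <= e / 2 / M2 * `|t| by near: t.
  by rewrite c0 subr0 in h.
have c3 : \forall t \near (0 : R), forall m, `|c m t| < d.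
  refine (@filter_forall _ _ (fun m t => `|c m t| < d) (nbhs (0 : R)) _ _) => m.
  have M0 : 0 < `|c' m| + 1 by rewrite ltr_wpDl.
  have t1 : \forall t \near (0 : R), `|t| < d / (`|c' m| + 1).
    apply/nbhs_norm0P; exists (d / (`|c' m| + 1)) => //=; exact: divr_gt0.
  near=> t.
  have h1 : forall m, `|c m t| <= (`|c' m| + 1) * `|t| by near: t.
  have h2 : `|t| < d / (`|c' m| + 1) by near: t.
  by apply: le_lt_trans (h1 m) _; rewrite mulrC -ltr_pdivlMr.
near=> t.
have -> : (phi \o g) t = phi (z + \sum_m ofR (c m t) *: b m).
  by rewrite /=; congr phi; near: t.
rewrite /= g0.
have H : `|phi (z + \sum_m ofR (c m t) *: b m) - phi z
    - \sum_m c m t * B m z| <= e / 2 / M1 * \sum_m `|c m t|.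
  apply: (dH z (fun m => c m t)); first by rewrite subrr rnorm0.
  by near: t.
have h1 : forall m, `|c m t| <= (`|c' m| + 1) * `|t| by near: t.
have h2 : forall m, `|c m t - t * c' m| <= e / 2 / M2 * `|t| by near: t.
set X := phi _ - phi z in H *.
have -> : X - t * \sum_m c' m * B m z =
    (X - \sum_m c m t * B m z) + \sum_m (c m t - t * c' m) * B m z.
  under [X in _ = _ + X]eq_bigr do rewrite mulrBl -mulrA.
  by rewrite sumrB -mulr_sumr; ring.
apply: le_trans (ler_normD _ _) _; rewrite [e in leRHS]splitr mulrDl lerD //.
  apply: le_trans H _; rewrite -mulrA ler_wpM2l ?divr_ge0 ?(ltW e0) //.
  rewrite ler_pdivrMl // -[M1]/(1 + _) mulrDl mul1r ler_wpDl //.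
  by rewrite mulr_suml; apply: ler_sum => m _; exact: h1.
apply: le_trans (ler_norm_sum _ _ _) _.
apply: (@le_trans _ _ (\sum_m e / 2 / M2 * `|t| * `|B m z|)).
  by apply: ler_sum => m _; rewrite normrM ler_wpM2r.
rewrite -mulr_sumr -!mulrA ler_wpM2l ?(ltW e0) // ler_wpM2l ?invr_ge0 //.
rewrite ler_pdivrMl // mulrC ler_wpM2r //.
by rewrite -[M2]/(1 + _) ler_wpDl.
Unshelve. all: by end_near. Qed.

End ChainRule.

(** * Smooth complex-valued functions on open sets of C^n *)

Section ComplexValued.
Context {R : realType}.
Implicit Types (a b c : Cx R) (r s t : R).

Lemma ReC_ImC_inj a b : ReC a = ReC b -> ImC a = ImC b -> a = b.
Proof. by case: a b => [x y] [x' y'] /= -> ->. Qed.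

Lemma ReCD a b : ReC (a + b) = ReC a + ReC b.
Proof. by case: a b => [x y] [x' y']. Qed.

Lemma ImCD a b : ImC (a + b) = ImC a + ImC b.
Proof. by case: a b => [x y] [x' y']. Qed.

Lemma ReCN a : ReC (- a) = - ReC a.
Proof. by case: a. Qed.

Lemma ImCN a : ImC (- a) = - ImC a.
Proof. by case: a. Qed.

Lemma ReCM a b : ReC (a * b) = ReC a * ReC b - ImC a * ImC b.
Proof. by case: a b => [x y] [x' y']. Qed.

Lemma ImCM a b : ImC (a * b) = ReC a * ImC b + ImC a * ReC b.
Proof. by case: a b => [x y] [x' y']. Qed.

Lemma ReC_ofR r : ReC (ofR r) = r.
Proof. by []. Qed.

Lemma ImC_ofR r : ImC (ofR r) = 0.
Proof. by []. Qed.

Lemma iE : ('i : Cx R) = mkC 0 1.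
Proof. by rewrite -[LHS](@complexiE R). Qed.

Lemma conjCE a : a^* = mkC (ReC a) (- ImC a).
Proof. by case: a. Qed.

Lemma ReC_conj a : ReC a^* = ReC a.
Proof. by rewrite conjCE. Qed.

Lemma ImC_conj a : ImC a^* = - ImC a.
Proof. by rewrite conjCE. Qed.

Lemma CE a : a = ofR (ReC a) + 'i * ofR (ImC a).
Proof. by rewrite iE; apply: ReC_ImC_inj; rewrite ?(ReCD, ImCD, ReCM, ImCM) /=; ring. Qed.

Lemma normC_ReC a : `|ReC a| <= rnorm (a : (Cx R)^o).
Proof. by rewrite -ofR_le ofR_rnorm; exact: (@normc_ge_Re R). Qed.

Lemma ImC_ReC a : ImC a = ReC (- 'i * a).
Proof. by rewrite iE mulNr ReCN ReCM /=; ring. Qed.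

Lemma normC_ImC a : `|ImC a| <= rnorm (a : (Cx R)^o).
Proof.
rewrite ImC_ReC; apply: le_trans (normC_ReC _) _.
by rewrite -ofR_le !ofR_rnorm normrM normrN normCi mul1r.
Qed.

Lemma continuous_ReC : continuous (ReC : Cx R -> R).
Proof.
move=> a; apply/(@cvgrPdist_lt _ _ _ (nbhs a)) => e e0.
apply/(@nbhs_rnorm R (Cx R)^o); exists e => // b /= ba.
rewrite -ReCN -ReCD; apply: le_lt_trans (normC_ReC _) _.
by move: ba; rewrite /rnorm distrC.
Qed.

Lemma continuous_ImC : continuous (ImC : Cx R -> R).
Proof.
move=> a; apply/(@cvgrPdist_lt _ _ _ (nbhs a)) => e e0.
apply/(@nbhs_rnorm R (Cx R)^o); exists e => // b /= ba.
rewrite -ImCN -ImCD; apply: le_lt_trans (normC_ImC _) _.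
by move: ba; rewrite /rnorm distrC.
Qed.

Lemma continuous_conjC : continuous (fun a : Cx R => a^*).
Proof.
move=> a; apply/(@cvgrPdist_lt _ _ _ (nbhs a)) => e e0.
apply/nbhs_normP; exists e => // b /= ba.
by rewrite -rmorphB norm_conjC.
Qed.

(** Complex differentiability, restricted to real increments and rewritten with real-valued norms:
    the bridge from holomorphy to derivatives along real lines. *)
Lemma diff_little (V W : normedModType (Cx R)) (G : V -> W) (z v : V) (e : R) :
  differentiable G z -> 0 < e ->
  \forall t \near (0 : R),
    rnorm (G (z + ofR t *: v) - G z - ofR t *: 'd G z v) <= e * `|t|.
Proof.
move=> dG e0.
have : h^-1 *: (G (h *: v + z) - G z) @[h --> (0 : Cx R)^'] --> 'd G z v.
  by rewrite -deriveE //; exact: (diff_derivable dG).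
have e0' : 0 < ofR e by rewrite -ofR0 ofR_lt.
move=> /cvgrPdist_le /(_ _ e0') H.
have /(@nbhs_rnorm R (Cx R)^o) [d d0 dH] : \forall h \near (0 : Cx R), h != 0 ->
    `|'d G z v - h^-1 *: (G (h *: v + z) - G z)| <= ofR e by exact: H.
apply/nbhs_norm0P; exists d => // t /= td.
have [->|t0] := eqVneq t 0.
  by rewrite ofR0 !scale0r addr0 subrr subr0 rnorm0 normr0 mulr0.
have t0' : ofR t != 0 by rewrite -ofR0 (inj_eq (@complexI R)).
have := dH (ofR t).
rewrite subr0 /rnorm normC_ofR => /(_ td t0').
rewrite -ofR_rnorm ofR_le => h.
have -> : G (z + ofR t *: v) - G z - ofR t *: 'd G z v =
    ofR (- t) *: ('d G z v - (ofR t)^-1 *: (G (ofR t *: v + z) - G z)).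
  rewrite ofRN scaleNr scalerBr scalerA mulfV // scale1r opprB.
  by rewrite [ofR t *: v + z]addrC.
rewrite -[ReC _]/(rnorm _).
by rewrite rnormZ normrN mulrC ler_wpM2r.
Qed.

Context {n : nat}.
Notation V := ('rV[Cx R]_n).
Implicit Types (f g : V -> Cx R) (z u v w : V) (A : set V).

(** Existence and value of the derivative in one relation, so that rules of calculus compose without
    separate derivability conditions. *)
Definition is_rd f z v c : Prop :=
  is_dl (fun p => ReC (f p)) z v (ReC c) /\
  is_dl (fun p => ImC (f p)) z v (ImC c).

Lemma rderivableP f z v : rderivable f z v -> is_rd f z v (rderive v f z).
Proof.
move=> [dr di]; split.
  by rewrite [ReC _](derive1E (ReC \o rline f z v)); exact: derivableP.
by rewrite [ImC _](derive1E (ImC \o rline f z v)); exact: derivableP.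
Qed.

Lemma is_rd_rderivable f z v c : is_rd f z v c -> rderivable f z v.
Proof. by move=> [[dr _] [di _]]; split; [exact: dr|exact: di]. Qed.

Lemma is_rd_rderive f z v c : is_rd f z v c -> rderive v f z = c.
Proof.
by move=> [dr di]; apply: ReC_ImC_inj; rewrite /rderive /ReC /ImC /= derive1E;
  [case: dr|case: di].
Qed.

Lemma near_line A z v : nbhs z A -> \forall t \near (0 : R), A (z + ofR t *: v).
Proof.
move=> /nbhs_rnorm [d d0 dA].
have M0 : 0 < 1 + rnorm v by rewrite ltr_pwDl ?rnorm_ge0.
apply/nbhs_norm0P; exists (d / (1 + rnorm v)) => /=; first exact: divr_gt0.
move=> t /= td; apply: dA; rewrite addrAC subrr add0r rnormZ.
apply: le_lt_trans (_ : `|t| * (1 + rnorm v) < _); last by rewrite -ltr_pdivlMr.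
by rewrite ler_wpM2l // lerDr.
Qed.

Lemma is_rd_near f g z v c :
  (\forall p \near z, f p = g p) -> is_rd f z v c -> is_rd g z v c.
Proof.
move=> /near_line -/(_ v) fg [dr di].
by split; [apply: near_eq_is_derive dr|apply: near_eq_is_derive di];
  apply: filterS fg => t ->.
Qed.

Lemma is_rd_eq f z v c c' : is_rd f z v c -> c = c' -> is_rd f z v c'.
Proof. by move=> ? <-. Qed.

Lemma is_rd_cst a z v : is_rd (fun=> a) z v 0.
Proof. by split; apply: is_derive_cst. Qed.

Lemma is_rdD f g z v a b :
  is_rd f z v a -> is_rd g z v b -> is_rd (fun p => f p + g p) z v (a + b).
Proof.
move=> [fr fi] [gr gi]; split; rewrite ?ReCD ?ImCD /is_dl.
  by under eq_fun do rewrite ReCD; apply: is_deriveD.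
by under eq_fun do rewrite ImCD; apply: is_deriveD.
Qed.

Lemma is_rdM f g z v a b : is_rd f z v a -> is_rd g z v b ->
  is_rd (fun p => f p * g p) z v (a * g z + f z * b).
Proof.
move=> [fr fi] [gr gi]; split; rewrite ?(ReCD, ImCD, ReCM, ImCM) /is_dl.
  under eq_fun do rewrite ReCM.
  apply: is_derive_eq; first exact: is_deriveB (is_deriveM fr gr) (is_deriveM fi gi).
  by rewrite /= ofR0 scale0r addr0 /GRing.scale /=; ring.
under eq_fun do rewrite ImCM.
apply: is_derive_eq; first exact: is_deriveD (is_deriveM fr gi) (is_deriveM fi gr).
by rewrite /= ofR0 scale0r addr0 /GRing.scale /=; ring.
Qed.

Lemma is_rd_conj f z v a : is_rd f z v a -> is_rd (fun p => (f p)^*) z v a^*.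
Proof.
move=> [fr fi]; split; rewrite ?ReC_conj ?ImC_conj /is_dl.
  by under eq_fun do rewrite ReC_conj.
by under eq_fun do rewrite ImC_conj; apply: is_deriveN.
Qed.

Lemma is_rdZ f z v a b : is_rd f z v b -> is_rd (fun p => a * f p) z v (a * b).
Proof.
move=> df; apply: is_rd_eq (is_rdM (is_rd_cst a z v) df) _.
by rewrite mul0r add0r.
Qed.

Lemma is_rdB f g z v a b :
  is_rd f z v a -> is_rd g z v b -> is_rd (fun p => f p - g p) z v (a - b).
Proof.
move=> df dg; have := is_rdD df (is_rdZ (-1) dg).
by rewrite mulN1r /is_rd /is_dl; under eq_fun do rewrite mulN1r;
  under [X in _ /\ is_derive _ _ X _ -> _]eq_fun do rewrite mulN1r.
Qed.

(** For a real-valued [f] this is the inverse rule for real functions. That case suffices for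
    squared norms of frames. *)
Lemma is_rdV f z v a : (forall p, ImC (f p) = 0) -> f z != 0 ->
  is_rd f z v a -> is_rd (fun p => (f p)^-1) z v (- a * ((f z)^-1 * (f z)^-1)).
Proof.
move=> f0 fz [fr fi].
have fE p : f p = ofR (ReC (f p)) by apply: ReC_ImC_inj; rewrite ?f0.
have VE r : (ofR r)^-1 = ofR r^-1 by rewrite [RHS](fmorphV (real_complex R)).
have rz : ReC (f z) != 0 by apply: contra_neq fz => r0; rewrite fE r0.
have a0 : ImC a = 0.
  have [_ <-] := fi; under eq_fun do rewrite f0.
  exact: derive_cst.
have aE : a = ofR (ReC a) by apply: ReC_ImC_inj; rewrite ?a0.
split; rewrite /is_dl.
  under eq_fun do rewrite fE VE ReC_ofR.
  have rz' : ReC (f (z + ofR 0 *: v)) != 0 by rewrite ofR0 scale0r addr0.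
  have [df Df] := fr.
  apply: DeriveDef; first exact: derivableV.
  rewrite deriveV // Df ofR0 scale0r addr0 /GRing.scale /=.
  rewrite [in RHS]aE [in RHS]fE VE !(ReCM, ReCN, ImCM, ImCN, ReC_ofR, ImC_ofR).
  by field.
under eq_fun do rewrite fE VE ImC_ofR.
have -> : ImC (- a * ((f z)^-1 * (f z)^-1)) = 0.
  rewrite aE fE VE !(ReCM, ReCN, ImCM, ImCN, ReC_ofR, ImC_ofR); ring.
exact: (is_derive_cst (0 : R)).
Qed.

Lemma is_rd_diff f z v : differentiable f z -> is_rd f z v ('d f z v).
Proof.
move=> df; split; apply/is_derive0P => e e0;
  have := diff_little v df e0; apply: filterS => t; rewrite ofR0 scale0r addr0;
  apply: le_trans.
  apply: le_trans (normC_ReC _); rewrite !(ReCD, ReCN).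
  by rewrite [ReC (_ *: _)]ReCM ReC_ofR ImC_ofR mul0r subr0.
apply: le_trans (normC_ImC _); rewrite !(ImCD, ImCN).
by rewrite [ImC (_ *: _)]ImCM ReC_ofR ImC_ofR mul0r addr0.
Qed.

End ComplexValued.

(** * Closure properties of [Ck], symmetry of second derivatives, composition with holomorphic
    maps *)

Section SmoothFunctions.
Context {R : realType} {n : nat}.
Notation V := ('rV[Cx R]_n).
Implicit Types (a b c : Cx R) (r s t : R).
Implicit Types (f g : V -> Cx R) (z u v w : V) (A B : set V).

Lemma continuous_Re f z :
  {for z, continuous f} -> {for z, continuous (fun p => ReC (f p))}.
Proof. by move=> cf; apply: continuous_comp => //; exact: continuous_ReC. Qed.

Lemma continuous_Im f z :
  {for z, continuous f} -> {for z, continuous (fun p => ImC (f p))}.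
Proof. by move=> cf; apply: continuous_comp => //; exact: continuous_ImC. Qed.

Lemma Ck_continuous k A f z : Ck k A f -> A z -> {for z, continuous f}.
Proof. by case: k => [|k] [+ _]; apply. Qed.

Lemma Ck_is_rd k A f z v : Ck k.+1 A f -> A z -> is_rd f z v (rderive v f z).
Proof. by move=> [_ /(_ v)[+ _]] Az => /(_ z Az)/rderivableP. Qed.

Lemma Ck_rderive k A f v : Ck k.+1 A f -> Ck k A (rderive v f).
Proof. by move=> [_ /(_ v)[]]. Qed.

Lemma CkW k A f : Ck k.+1 A f -> Ck k A f.
Proof.
elim: k f => [f [cf _]|k IH f [cf df]]; first by split.
by split=> // v; have [dfv Cf] := df v; split=> //; exact: IH.
Qed.

(** Continuity and derivatives at a point are those of the ambient space, not relative to [A], so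
    that every clause of [Ck] can be checked point by point. *)
Lemma Ck_local k A f :
  (forall z, A z -> exists2 B, B z & Ck k B f) -> Ck k A f.
Proof.
elim: k f => [|k IH] f H.
  by split=> // z /H[B Bz /Ck_continuous]; apply.
split=> [z /H[B Bz /Ck_continuous]|v]; first exact.
split=> [z /H[B Bz [_ /(_ v)[+ _]]]|]; first exact.
by apply: IH => z /H[B Bz Cf]; exists B => //; exact: Ck_rderive.
Qed.

Lemma Ck_sub k A B f : B `<=` A -> Ck k A f -> Ck k B f.
Proof. by move=> BA Cf; apply: Ck_local => z /BA Az; exists A. Qed.

Lemma continuous_near f g z : (\forall p \near z, f p = g p) ->
  {for z, continuous f} -> {for z, continuous g}.
Proof.
move=> fg cf.
have : g p @[p --> z] --> f z by exact: cvg_trans (near_eq_cvg fg) cf.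
by rewrite (nbhs_singleton fg).
Qed.

Lemma Ck_eq k A f g : open A -> (forall z, A z -> f z = g z) ->
  Ck k A f -> Ck k A g.
Proof.
move=> oA; elim: k f g => [|k IH] f g fg Cf;
  (have fgz z : A z -> \forall p \near z, f p = g p
    by move=> Az; exact: (filterS fg (open_nbhs_nbhs (conj oA Az)))).
  by split=> // z Az; apply: continuous_near (fgz z Az) (Ck_continuous Cf Az).
have dg z v : A z -> is_rd g z v (rderive v f z).
  by move=> Az; apply: is_rd_near (fgz z Az) (Ck_is_rd v Cf Az).
split=> [z Az|v].
  exact: continuous_near (fgz z Az) (Ck_continuous Cf Az).
split=> [z Az|]; first exact: is_rd_rderivable (dg z v Az).
apply: IH (Ck_rderive v Cf) => z Az.
by rewrite (is_rd_rderive (dg z v Az)).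
Qed.

(** The induction step in usable form: explicit formulas [df] replace [rderive], with which they
    agree on the open set [A]. *)
Lemma CkS k A f (df : V -> V -> Cx R) : open A ->
  (forall z, A z -> {for z, continuous f}) ->
  (forall v z, A z -> is_rd f z v (df v z)) ->
  (forall v, Ck k A (df v)) -> Ck k.+1 A f.
Proof.
move=> oA cf dfE Cdf; split=> // v; split=> [z Az|].
  exact: is_rd_rderivable (dfE v z Az).
by apply: Ck_eq (Cdf v) => // z Az; rewrite (is_rd_rderive (dfE v z Az)).
Qed.

Lemma Ck_cst k A a : open A -> Ck k A (fun=> a).
Proof.
move=> oA; elim: k a => [|k IH] a.
  by split=> // z _; exact: cst_continuous.
apply: (CkS (df := fun _ _ => 0)) => // [z _|v z _].
  exact: cst_continuous.
exact: is_rd_cst.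
Qed.

Lemma CkD k A f g : open A -> Ck k A f -> Ck k A g ->
  Ck k A (fun z => f z + g z).
Proof.
move=> oA; elim: k f g => [|k IH] f g Cf Cg.
  split=> // z Az.
  exact: continuousD (Ck_continuous Cf Az) (Ck_continuous Cg Az).
apply: (CkS (df := fun v z => rderive v f z + rderive v g z)) => //.
- move=> z Az.
  exact: continuousD (Ck_continuous Cf Az) (Ck_continuous Cg Az).
- by move=> v z Az; exact: is_rdD (Ck_is_rd v Cf Az) (Ck_is_rd v Cg Az).
- by move=> v; exact: IH (Ck_rderive v Cf) (Ck_rderive v Cg).
Qed.

Lemma CkM k A f g : open A -> Ck k A f -> Ck k A g ->
  Ck k A (fun z => f z * g z).
Proof.
move=> oA; elim: k f g => [|k IH] f g Cf Cg.
  split=> // z Az.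
  exact: continuousM (Ck_continuous Cf Az) (Ck_continuous Cg Az).
apply: (CkS (df := fun v z => rderive v f z * g z + f z * rderive v g z)) => //.
- move=> z Az.
  exact: continuousM (Ck_continuous Cf Az) (Ck_continuous Cg Az).
- by move=> v z Az; exact: is_rdM (Ck_is_rd v Cf Az) (Ck_is_rd v Cg Az).
- move=> v; apply: CkD => //; apply: IH.
  + exact: Ck_rderive.
  + exact: CkW.
  + exact: CkW.
  + exact: Ck_rderive.
Qed.

Lemma CkZ k A f a : open A -> Ck k A f -> Ck k A (fun z => a * f z).
Proof. by move=> oA; apply: CkM => //; exact: Ck_cst. Qed.

Lemma CkN k A f : open A -> Ck k A f -> Ck k A (fun z => - f z).
Proof.
move=> oA Cf; apply: Ck_eq (CkZ (-1) oA Cf) => // z _.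
by rewrite mulN1r.
Qed.

Lemma CkB k A f g : open A -> Ck k A f -> Ck k A g ->
  Ck k A (fun z => f z - g z).
Proof. by move=> oA Cf Cg; apply: CkD => //; exact: CkN. Qed.

Lemma Ck_conj k A f : open A -> Ck k A f -> Ck k A (fun z => (f z)^*).
Proof.
move=> oA; elim: k f => [|k IH] f Cf.
  split=> // z Az; apply: continuous_comp (Ck_continuous Cf Az) _.
  exact: continuous_conjC.
apply: (CkS (df := fun v z => (rderive v f z)^*)) => //.
- move=> z Az; apply: continuous_comp (Ck_continuous Cf Az) _.
  exact: continuous_conjC.
- by move=> v z Az; exact: is_rd_conj (Ck_is_rd v Cf Az).
- by move=> v; exact: IH (Ck_rderive v Cf).
Qed.

Lemma CkV k A f : open A -> (forall z, ImC (f z) = 0) ->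
  (forall z, A z -> f z != 0) -> Ck k A f -> Ck k A (fun z => (f z)^-1).
Proof.
move=> oA f0 fn0; elim: k => [|k IH] Cf.
  split=> // z Az; apply: continuousV (fn0 z Az) (Ck_continuous Cf Az).
apply: (CkS (df := fun v z => - rderive v f z * ((f z)^-1 * (f z)^-1))) => //.
- by move=> z Az; apply: continuousV (fn0 z Az) (Ck_continuous Cf Az).
- by move=> v z Az; exact: is_rdV (fn0 z Az) (Ck_is_rd v Cf Az).
- have C' := IH (CkW Cf).
  by move=> v; apply: CkM => //; [apply/CkN/Ck_rderive|apply: CkM].
Qed.

(** Bootstrapping: if [f] is of class [Ck k], so is each derivative [f * eta v], and [f] gains one
    order. *)
Lemma Cinfty_log_derivative A f (eta : V -> V -> Cx R) : open A ->
  (forall z, A z -> {for z, continuous f}) ->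
  (forall v z, A z -> is_rd f z v (f z * eta v z)) ->
  (forall v, Cinfty A (eta v)) -> Cinfty A f.
Proof.
move=> oA cf df Ceta; elim=> [|k IH]; first by split.
apply: (CkS (df := fun v z => f z * eta v z)) => // v.
by apply: CkM => //; exact: Ceta.
Qed.

Lemma rderiveC A f u v z : open A -> Cinfty A f -> A z ->
  rderive u (rderive v f) z = rderive v (rderive u f) z.
Proof.
move=> oA Cf Az; have Cf2 := Cf 2%N; have Cf1 := Cf 1%N.
have Azn := open_nbhs_nbhs (conj oA Az).
have Cd x := Ck_rderive x Cf2.
have Cdd x y : {for z, continuous (rderive x (rderive y f))}.
  exact: Ck_continuous (Ck_rderive x (Cd y)) Az.
apply: ReC_ImC_inj.
- apply: (@schwarz _ _ A (fun p => ReC (f p)) (fun p => ReC (rderive v f p))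
   (fun p => ReC (rderive u f p)) (fun p => ReC (rderive u (rderive v f) p))
   (fun p => ReC (rderive v (rderive u f) p)) v u z Azn).
  + move=> p Ap; split.
    * exact: (Ck_is_rd v Cf1 Ap).1.
    * exact: (Ck_is_rd u Cf1 Ap).1.
    * exact: (Ck_is_rd u (Cd v) Ap).1.
    * exact: (Ck_is_rd v (Cd u) Ap).1.
  + exact: continuous_Re.
  + exact: continuous_Re.
- apply: (@schwarz _ _ A (fun p => ImC (f p)) (fun p => ImC (rderive v f p))
   (fun p => ImC (rderive u f p)) (fun p => ImC (rderive u (rderive v f) p))
   (fun p => ImC (rderive v (rderive u f) p)) v u z Azn).
  + move=> p Ap; split.
    * exact: (Ck_is_rd v Cf1 Ap).2.
    * exact: (Ck_is_rd u Cf1 Ap).2.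
    * exact: (Ck_is_rd u (Cd v) Ap).2.
    * exact: (Ck_is_rd v (Cd u) Ap).2.
  + exact: continuous_Im.
  + exact: continuous_Im.
Qed.

(** The basis of C^n over the reals formed by the standard vectors and their multiples by ['i], the
    latter marked by [true]. It provides the finite family of directions for [is_derive_curve]. *)
Definition rbasis (m : 'I_n * bool) : V :=
  if m.2 then 'i *: delta_mx 0 m.1 else delta_mx 0 m.1.

Definition rcoord (m : 'I_n * bool) w : R :=
  if m.2 then ImC (w 0 m.1) else ReC (w 0 m.1).

Lemma rbasis_decomp w : w = \sum_m ofR (rcoord m w) *: rbasis m.
Proof.
rewrite [LHS]row_sum_delta.
rewrite -(pair_bigA _ (fun j (b : bool) =>
  ofR (rcoord (j, b) w) *: rbasis (j, b))) /=.
apply: eq_bigr => j _; rewrite big_bool /rcoord /rbasis /=.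
by rewrite scalerA -scalerDl addrC mulrC -CE.
Qed.

Lemma rnorm_rcoord m w : `|rcoord m w| <= rnorm w.
Proof.
have h : rnorm (w 0 m.1 : (Cx R)^o) <= rnorm w.
  rewrite -ofR_le !ofR_rnorm [leRHS]/Num.Def.normr /= mx_normE.
  rewrite -[leLHS]nngE num_le.
  exact: (le_bigmax _ (fun i : 'I_1 * 'I_n => `|w i.1 i.2|%:nng) (0, m.1)).
by apply: le_trans h; rewrite /rcoord; case: m.2;
  [exact: normC_ImC|exact: normC_ReC].
Qed.

Lemma rcoordD m v w : rcoord m (v + w) = rcoord m v + rcoord m w.
Proof. by rewrite /rcoord mxE ReCD ImCD; case: m.2. Qed.

Lemma rcoordN m v : rcoord m (- v) = - rcoord m v.
Proof. by rewrite /rcoord mxE ReCN ImCN; case: m.2. Qed.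

Lemma rcoordZ m r v : rcoord m (ofR r *: v) = r * rcoord m v.
Proof.
rewrite /rcoord mxE ReCM ImCM ReC_ofR ImC_ofR !mul0r subr0 addr0.
by case: m.2.
Qed.

Lemma rcoord0 m : rcoord m 0 = 0.
Proof. by rewrite /rcoord mxE; case: m.2. Qed.

(** The curve [G (z + t u)] and the straight line through [G z] with direction [w] have the same
    first-order coordinates in [rbasis], so [is_derive_curve] gives the same derivative of [f] along
    both. *)
Lemma is_rd_comp A f (G : V -> V) z u : nbhs (G z) A -> Ck 1 A f ->
  differentiable G z ->
  is_rd (f \o G) z u (rderive ('d G z u) f (G z)).
Proof.
move=> An Cf dG.
set w := 'd G z u.
have AG : A (G z) := nbhs_singleton An.
have Cdf v : {for G z, continuous (rderive v f)}.
  exact: Ck_continuous (Ck_rderive v Cf) AG.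
have key (phi : V -> R) (B : V -> V -> R) (c : R) :
    (forall v p, A p -> is_dl phi p v (B v p)) ->
    (forall v, {for G z, continuous (B v)}) -> c = B w (G z) ->
    is_dl (fun p => phi (G p)) z u c.
  move=> dphi cB ->.
  have H := @is_derive_curve _ _ _ rbasis phi (fun m => B (rbasis m)) A (G z) An
    (fun m p => dphi (rbasis m) p) (fun m => cB (rbasis m)).
  (* Linearity in the direction is not part of the definition of [rderive]; it is obtained by
     applying [H] to the straight line. *)
  have -> : B w (G z) = \sum_m rcoord m w * B (rbasis m) (G z).
    have [_ <-] := dphi w (G z) AG.
    have [|||m|_ <-] := H (fun t => G z + ofR t *: w)
      (fun m t => t * rcoord m w) (fun m => rcoord m w); last by [].
    - by rewrite ofR0 scale0r addr0.
    - apply: filterE => t; congr (_ + _).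
      rewrite [LHS]rbasis_decomp; apply: eq_bigr => m _.
      by rewrite rcoordZ.
    - by move=> m; rewrite mul0r.
    - apply/is_derive0P => e e0; apply: filterE => t.
      by rewrite mul0r subr0 subrr normr0 mulr_ge0 // ltW.
  apply: (H (fun t => G (z + ofR t *: u))
    (fun m t => rcoord m (G (z + ofR t *: u) - G z))).
  - by rewrite ofR0 scale0r addr0.
  - by apply: filterE => t; rewrite -rbasis_decomp addrCA subrr addr0.
  - by move=> m; rewrite ofR0 scale0r addr0 subrr rcoord0.
  - move=> m; apply/is_derive0P => e e0.
    have := diff_little u dG e0; apply: filterS => t; apply: le_trans.
    apply: le_trans (rnorm_rcoord m _).
    by rewrite ofR0 scale0r addr0 subrr rcoord0 subr0 !(rcoordD, rcoordN) rcoordZ.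
split.
- exact: (key (fun p => ReC (f p)) (fun v p => ReC (rderive v f p)) _
    (fun v p Ap => (Ck_is_rd v Cf Ap).1) (fun v => continuous_Re (Cdf v)) erefl).
- exact: (key (fun p => ImC (f p)) (fun v p => ImC (rderive v f p)) _
    (fun v p Ap => (Ck_is_rd v Cf Ap).2) (fun v => continuous_Im (Cdf v)) erefl).
Qed.

End SmoothFunctions.

(** * Calculus on complex manifolds *)

Section ManifoldCalculus.
Context {R : realType} {n : nat} {X : complexManifold R n}.
Implicit Types (x : X) (W : set X) (i : mindex X) (f g : X -> Cx R).
Implicit Types (u v z : 'rV[Cx R]_n).

Lemma chart_imageP i W z :
  (mchart i @` (W `&` mdom i)) z <-> (mchart i @` mdom i) z /\ W (minv i z).
Proof.
split=> [[x [Wx dx] <-]|[[x dx <-]]].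
  by rewrite mchartK //; split=> //; exists x.
by rewrite mchartK // => Wx; exists x.
Qed.

Lemma open_chart_image i W : open W -> open (mchart i @` (W `&` mdom i)).
Proof.
move=> oW; rewrite openE => z /chart_imageP [dz Wz].
have h1 := open_nbhs_nbhs (conj (@mcod_open _ _ X i) dz).
have h2 : nbhs z (minv i @^-1` W).
  by apply: (minv_continuous dz); exact: open_nbhs_nbhs.
by apply: filterS2 h1 h2 => p dp Wp; apply/chart_imageP.
Qed.

Lemma smooth_on_local W f :
  (forall x, W x -> exists2 W', W' x & smooth_on W' f) -> smooth_on W f.
Proof.
move=> H i k; apply: Ck_local => _ [x [Wx dx] <-].
have [W' W'x Cf] := H x Wx.
by exists (mchart i @` (W' `&` mdom i)); [exists x|exact: Cf].
Qed.

Lemma smooth_on_sub W W' f : W' `<=` W -> smooth_on W f -> smooth_on W' f.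
Proof. by move=> sW Cf; apply: smooth_on_local => x /sW Wx; exists W. Qed.

Lemma smooth_on_eq W f g : open W -> (forall x, W x -> f x = g x) ->
  smooth_on W f -> smooth_on W g.
Proof.
move=> oW fg Cf i k; apply: Ck_eq (Cf i k); first exact: open_chart_image.
by move=> z /chart_imageP [_ Wz] /=; exact: fg.
Qed.

Lemma smooth_onD W f g : open W -> smooth_on W f -> smooth_on W g ->
  smooth_on W (fun x => f x + g x).
Proof.
by move=> oW Cf Cg i k; apply: CkD (Cf i k) (Cg i k); exact: open_chart_image.
Qed.

Lemma smooth_onB W f g : open W -> smooth_on W f -> smooth_on W g ->
  smooth_on W (fun x => f x - g x).
Proof.
by move=> oW Cf Cg i k; apply: CkB (Cf i k) (Cg i k); exact: open_chart_image.
Qed.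

Lemma smooth_onM W f g : open W -> smooth_on W f -> smooth_on W g ->
  smooth_on W (fun x => f x * g x).
Proof.
by move=> oW Cf Cg i k; apply: CkM (Cf i k) (Cg i k); exact: open_chart_image.
Qed.

Lemma smooth_onZ W f (a : Cx R) : open W -> smooth_on W f ->
  smooth_on W (fun x => a * f x).
Proof.
by move=> oW Cf i k; apply: CkZ (Cf i k); exact: open_chart_image.
Qed.

Lemma smooth_on_conj W f : open W -> smooth_on W f ->
  smooth_on W (fun x => (f x)^*).
Proof.
by move=> oW Cf i k; apply: Ck_conj (Cf i k); exact: open_chart_image.
Qed.

Lemma mdom_chart_at x : mdom (chart_at x) x.
Proof. by rewrite /chart_at; case: cid. Qed.

Lemma dfun_is_rd W f x (v : tangent x) : smooth_on W f -> W x ->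
  is_rd (f \o minv (chart_at x)) (mchart (chart_at x) x) v (dfun f v).
Proof.
move=> Cf Wx; apply: (Ck_is_rd (k := 0)); first exact: Cf.
by exists x => //; split=> //; exact: mdom_chart_at.
Qed.

Lemma dfunD W f g x (v : tangent x) : smooth_on W f -> smooth_on W g -> W x ->
  dfun (fun y => f y + g y) v = dfun f v + dfun g v.
Proof.
move=> Cf Cg Wx; apply: is_rd_rderive.
exact: is_rdD (dfun_is_rd v Cf Wx) (dfun_is_rd v Cg Wx).
Qed.

(** Chain rule for the transition map from chart [i] to [chart_at x], through which [dfun] and
    [coordvec] are defined. *)
Lemma dfun_coordvec W f i x u : open W -> smooth_on W f -> W x -> mdom i x ->
  dfun f (coordvec i u x) = rderive u (f \o minv i) (mchart i x).
Proof.
move=> oW Cf Wx dx; set c := chart_at x.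
have cx : mdom c x := mdom_chart_at x.
have oA := open_chart_image (i := c) oW.
have dG := mtransition_holomorphic dx cx.
have GE : (mchart c \o minv i) (mchart i x) = mchart c x.
  by rewrite /= mchartK.
have Az : nbhs ((mchart c \o minv i) (mchart i x)) (mchart c @` (W `&` mdom c)).
  by rewrite GE; apply: open_nbhs_nbhs; split=> //; exists x.
apply/esym/is_rd_rderive.
have := is_rd_comp u Az (Cf c 1%N) dG.
rewrite GE; apply: is_rd_near.
have Bz : (mchart i @` (mdom c `&` mdom i)) (mchart i x) by exists x.
have oB := open_chart_image (i := i) (@mdom_open _ _ X c).
apply: filterS (open_nbhs_nbhs (conj oB Bz)).
by move=> z /chart_imageP[_ cz] /=; rewrite mchartK.
Qed.

Lemma coordvecD i u v x : coordvec i (u + v) x = coordvec i u x + coordvec i v x.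
Proof. exact: linearD. Qed.

Lemma coordvecZ i (a : Cx R) u x : coordvec i (a *: u) x = a *: coordvec i u x.
Proof. exact: linearZ. Qed.

(** Near the point, the transition map from a chart to itself is the identity. Hence every tangent
    vector is the value of a coordinate field, and identities on coordinate fields become identities
    on tangent vectors. *)
Lemma coordvec_chart_at x u : coordvec (chart_at x) u x = u.
Proof.
have cx := mdom_chart_at x.
rewrite /coordvec -deriveE; last exact: (mtransition_holomorphic cx cx).
rewrite -[RHS](derive_id (mchart (chart_at x) x) u).
apply: near_eq_derive.
have Az : (mchart (chart_at x) @` mdom (chart_at x)) (mchart (chart_at x) x).
  by exists x.
apply: filterS (open_nbhs_nbhs (conj (@mcod_open _ _ X _) Az)).
by move=> _ [y dy <-] /=; rewrite mchartK.
Qed.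

(** The Cauchy-Riemann equations: the real directional derivatives of [f] are values of a complex
    linear differential. *)
Lemma dfun_holomorphic W f x (v : tangent x) : holomorphic_on W f -> W x ->
  dfun f (cplxJ v) = 'i * dfun f v.
Proof.
move=> hf Wx; have df := hf _ x Wx (mdom_chart_at x).
rewrite /dfun (is_rd_rderive (is_rd_diff _ df)).
by rewrite (is_rd_rderive (is_rd_diff _ df)) linearZ.
Qed.

End ManifoldCalculus.

(** * Chern connections *)

Section Frames.
Context {R : realType} {n : nat} {X : complexManifold R n}.
Variables (L : holLineBundle X) (h : hermitianMetric L).
Implicit Types (x : X) (j k : lindex L) (u v : 'rV[Cx R]_n).

Lemma lcoefD j x (s t : L x) : ldom j x -> lcoef j (s + t) = lcoef j s + lcoef j t.
Proof.
by move=> dx; rewrite -[s in LHS](lcoefK s dx) -[t in LHS](lcoefK t dx)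
  -scalerDl lframeK.
Qed.

Lemma lcoefZ j x (c : Cx R) (s : L x) : ldom j x -> lcoef j (c *: s) = c * lcoef j s.
Proof.
by move=> dx; rewrite -[s in LHS](lcoefK s dx) scalerA lframeK.
Qed.

Lemma lcoefB j x (s t : L x) : ldom j x -> lcoef j (s - t) = lcoef j s - lcoef j t.
Proof.
by move=> dx; rewrite -scaleN1r lcoefD // lcoefZ // mulN1r.
Qed.

Lemma lframe_neq0 j x : ldom j x -> lframe j x != 0.
Proof.
move=> dx; apply/eqP => e0.
have := lframeK 1 dx; rewrite scale1r e0 -(scale0r (lframe j x)) lframeK //.
by move/esym/eqP; rewrite oner_eq0.
Qed.

Lemma hmetD x (s s' t : L x) : h x (s + s') t = h x s t + h x s' t.
Proof. by have := hmet_linear h 1 s s' t; rewrite scale1r mul1r. Qed.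

Lemma hmet0 x (t : L x) : h x 0 t = 0.
Proof. by apply: (@addrI _ (h x 0 t)); rewrite -hmetD !addr0. Qed.

Lemma hmetZ x (c : Cx R) (s t : L x) : h x (c *: s) t = c * h x s t.
Proof. by have := hmet_linear h c s 0 t; rewrite hmet0 !addr0. Qed.

Lemma hmetZr x (c : Cx R) (s t : L x) : h x s (c *: t) = c^* * h x s t.
Proof. by rewrite (hmet_conj h _ s) hmetZ rmorphM /= -(hmet_conj h t s). Qed.

Lemma hmetB x (s s' t : L x) : h x (s - s') t = h x s t - h x s' t.
Proof. by rewrite hmetD -scaleN1r hmetZ mulN1r. Qed.

Lemma hmetBr x (s t t' : L x) : h x s (t - t') = h x s t - h x s t'.
Proof. by rewrite (hmet_conj h _ s) hmetB rmorphB /= -!(hmet_conj h _ s). Qed.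

Lemma ImC_hmet x (s : L x) : ImC (h x s s) = 0.
Proof.
have := congr1 (@ImC R) (hmet_conj h s s); rewrite ImC_conj => e.
lra.
Qed.

Lemma hmet_frame_neq0 j x : ldom j x -> h x (lframe j x) (lframe j x) != 0.
Proof. by move=> dx; rewrite gt_eqF // hmet_pos //; apply/eqP/lframe_neq0. Qed.

(** The connection axioms concern smooth sections, whereas transition functions are only assumed
    complex differentiable; this lemma allows [D] to be applied to frames. *)
Lemma lframe_smooth j : smooth_section (ldom j) (lframe j).
Proof.
move=> k i; set W := ldom j `&` ldom k.
have oW : open W by apply: openI; exact: ldom_open.
have oA := open_chart_image (i := i) oW.
set A := mchart i @` _ in oA *.
pose f := (fun x => lcoef k (lframe j x)) \o minv i.
pose a := (fun x => h x (lframe j x) (lframe j x)) \o minv i.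
pose b := (fun x => h x (lframe k x) (lframe k x)) \o minv i.
have AW z : A z -> ldom j (minv i z) /\ ldom k (minv i z).
  by move=> /chart_imageP[].
have df z : A z -> differentiable f z.
  move=> [x [[jx kx] dx] <-].
  exact: (@ltransition_holomorphic _ _ _ L k j i x).
have Ca : Cinfty A a.
  have := @hmet_smooth _ _ _ L h j i; rewrite -/a => Ca k'; apply: Ck_sub (Ca k').
  by move=> _ [x [[jx kx] dx] <-]; exists x.
have Cb : Cinfty A b.
  have := @hmet_smooth _ _ _ L h k i; rewrite -/b => Cb k'; apply: Ck_sub (Cb k').
  by move=> _ [x [[jx kx] dx] <-]; exists x.
have a0 z : A z -> a z != 0 by move=> /AW[jz _]; exact: hmet_frame_neq0.
have b0 z : A z -> b z != 0 by move=> /AW[_ kz]; exact: hmet_frame_neq0.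
have aE z : A z -> a z = f z * (f z)^* * b z.
  move=> /AW[jz kz]; rewrite /a /f /b /=.
  by rewrite -{1 2}(lcoefK (lframe j (minv i z)) kz) hmetZ hmetZr mulrA.
pose la v z := (rderive v a z - 'i * rderive ('i *: v) a z) * (a z)^-1.
pose lb v z := (rderive v b z - 'i * rderive ('i *: v) b z) * (b z)^-1.
(* The logarithmic derivative of [f], expressed through the smooth functions [a] and [b] alone. *)
pose eta v z := 2^-1 * (la v z - lb v z).
apply: (Cinfty_log_derivative (eta := eta)) => //.
- by move=> z /df /differentiable_continuous.
- move=> v z Az.
  have fd w : is_rd f z w ('d f z w) by apply/is_rd_diff/df.
  apply: is_rd_eq (fd v) _.
  have ad w : rderive w a z = ('d f z w * (f z)^* + f z * ('d f z w)^*) * b z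
      + f z * (f z)^* * rderive w b z.
    apply: is_rd_rderive.
    apply: is_rd_near (is_rdM (is_rdM (fd w) (is_rd_conj (fd w)))
      (Ck_is_rd w (Cb 1%N) Az)).
    by apply: filterS (open_nbhs_nbhs (conj oA Az)) => p /aE.
  have f0 : f z != 0.
    by apply: contra_neq (a0 z Az); rewrite aE // => ->; rewrite !mul0r.
  have fc0 : (f z)^* != 0 by rewrite conjC_eq0.
  have bz := b0 z Az.
  (* The differential of [f] is complex linear and that of its conjugate antilinear, so subtracting
     ['i] times the derivative along ['i *: v] doubles the former and cancels the latter. *)
  have dJ : 'd f z ('i *: v) = 'i * 'd f z v by rewrite linearZ.
  have cJ : ('i * 'd f z v)^* = - 'i * ('d f z v)^*.
    by rewrite rmorphM /= conjCi.
  rewrite /eta /la /lb !ad dJ (aE z Az) cJ.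
  have ii : ('i : Cx R) * 'i = -1 by rewrite -expr2 sqrCi.
  rewrite -/f; move: (b z) (rderive v b z) (rderive ('i *: v) b z) (f z)
    ('d f z v) (f z)^* ('d f z v)^* fc0 f0 bz
    => bz bv biv fz d fc dc fc0 f0 bz0.
  have -> : (d * fc + fz * dc) * bz + fz * fc * bv
      - 'i * (('i * d * fc + fz * (- 'i * dc)) * bz + fz * fc * biv)
      = (d * fc + fz * dc) * bz + fz * fc * (bv - 'i * biv)
        + ('i * 'i) * (fz * dc - d * fc) * bz by ring.
  rewrite ii; field.
  by rewrite fc0 f0 bz0.
- move=> v k'.
  have Cl c : Cinfty A c -> (forall p, ImC (c p) = 0) ->
      (forall z, A z -> c z != 0) -> forall l, Ck l A (fun z =>
      (rderive v c z - 'i * rderive ('i *: v) c z) * (c z)^-1).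
    move=> Cc c0 cn0 l; apply: CkM => //; last exact: CkV.
    by apply: CkB => //; [|apply: CkZ => //]; apply: Ck_rderive; exact: Cc.
  apply: CkZ => //; apply: CkB => //.
    by apply: (Cl a) => // p; exact: ImC_hmet.
  by apply: (Cl b) => // p; exact: ImC_hmet.
Qed.

End Frames.

(** * The curvature of the Chern connection in a holomorphic frame *)

Section ChernCurvature.
Context {R : realType} {n : nat} {X : complexManifold R n}.
Variables (L : holLineBundle X) (h : hermitianMetric L) (D : connection L).
Variable F : tensor2 X.
Arguments F : clear implicits.
Hypotheses (hD : is_chern h D) (hF : is_curvature D F).
Implicit Types (x : X) (W : set X) (s t : section L).

Lemma nablaZ W (c : Cx R) s x (v : tangent x) : open W -> smooth_section W s ->
  W x -> D (fun y => c *: s y) x v = c *: D s x v.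
Proof.
move=> oW Cs Wx.
(* Splitting [c] as [(c - 1) + 1] brings the section into the form required by [nabla_linear]. *)
have -> : (fun y => c *: s y) = (fun y => (c - 1) *: s y + s y).
  by apply: functional_extensionality_dep => y;
    rewrite -{3}[s y]scale1r -scalerDl subrK.
rewrite (nabla_linear D (c - 1) oW Cs Cs v Wx).
by rewrite -{2}[nabla D s v]scale1r -scalerDl subrK.
Qed.

Variables (j : lindex L) (i : mindex X).
Implicit Types (u v w : 'rV[Cx R]_n).

Let U : set X := ldom j `&` mdom i.

Definition cov u : section L := fun y => D (lframe j) y (coordvec i u y).

(** The connection form theta, with D e = theta e for the frame e, evaluated on the coordinate field
    of [u]. *)
Definition conn_form u x : Cx R := lcoef j (cov u x).

(** The coefficient of the iterated covariant derivative of the frame, first along [v], then along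
    [u]. *)
Definition cov2 u v x : Cx R := lcoef j (D (cov v) x (coordvec i u x)).

Let oU : open U.
Proof. by apply: openI; [exact: ldom_open|exact: mdom_open]. Qed.

Let nabla_frame_smooth : smooth_lform1 (ldom j) (D (lframe j)).
Proof. by apply: nabla_smooth; [exact: ldom_open|exact: lframe_smooth]. Qed.

Lemma cov_smooth u : smooth_section U (cov u).
Proof. exact: nabla_frame_smooth.2. Qed.

Lemma conn_form_smooth u : smooth_on U (conn_form u).
Proof.
apply: smooth_on_sub (cov_smooth u j) => x Ux.
by split=> //; case: Ux.
Qed.

Let nabla_cov_smooth v : smooth_lform1 U (D (cov v)).
Proof. by apply: nabla_smooth => //; exact: cov_smooth. Qed.

Lemma cov2_smooth u v : smooth_on U (cov2 u v).
Proof.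
apply: smooth_on_sub ((nabla_cov_smooth v).2 i u j) => x Ux.
by case: (Ux) => jx ix; split.
Qed.

Lemma cov2Dl u v w x : U x -> cov2 (u + v) w x = cov2 u w x + cov2 v w x.
Proof.
move=> Ux; have [jx _] := Ux.
by rewrite /cov2 coordvecD ((nabla_cov_smooth w).1 x Ux).1 lcoefD.
Qed.

Lemma cov2Zl (r : R) u w x : U x -> cov2 (ofR r *: u) w x = ofR r * cov2 u w x.
Proof.
move=> Ux; have [jx _] := Ux.
by rewrite /cov2 coordvecZ ((nabla_cov_smooth w).1 x Ux).2 lcoefZ.
Qed.

Lemma cov2Dr u v w x : U x -> cov2 u (v + w) x = cov2 u v x + cov2 u w x.
Proof.
move=> Ux; have [jx _] := Ux; rewrite /cov2.
have E y : U y -> cov (v + w) y = 1 *: cov v y + cov w y.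
  move=> [jy _]; rewrite scale1r /cov coordvecD.
  exact: (nabla_frame_smooth.1 y jy).1.
rewrite (nabla_local D oU (@cov_smooth (v + w)) E _ Ux).
rewrite (nabla_linear D 1 oU (@cov_smooth v) (@cov_smooth w) _ Ux).
by rewrite scale1r lcoefD.
Qed.

Lemma cov2Zr (r : R) u w x : U x -> cov2 u (ofR r *: w) x = ofR r * cov2 u w x.
Proof.
move=> Ux; have [jx _] := Ux; rewrite /cov2.
have E y : U y -> cov (ofR r *: w) y = ofR r *: cov w y.
  move=> [jy _]; rewrite /cov coordvecZ.
  exact: (nabla_frame_smooth.1 y jy).2.
rewrite (nabla_local D oU (@cov_smooth (ofR r *: w)) E _ Ux).
by rewrite (nablaZ _ _ oU (@cov_smooth w) Ux) lcoefZ.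
Qed.

(** In the trivialization used by [dbarL], the coefficient of the frame is a holomorphic transition
    function. *)
Lemma dbarL_frame x (v : tangent x) : ldom j x -> dbarL (lframe j) v = 0.
Proof.
move=> jx; have tx : ldom (triv_at L x) x by rewrite /triv_at; case: cid.
rewrite /dbarL /dbar.
rewrite (dfun_holomorphic v (@ltransition_holomorphic _ _ _ L (triv_at L x) j)).
  by rewrite mulrA -expr2 sqrCi mulN1r subrr mulr0 scale0r.
by split.
Qed.

(** The (0,1)-part of D e is [dbarL] of the holomorphic frame e, hence zero: theta is of type
    (1,0). *)
Lemma nabla_frameJ x (v : tangent x) : ldom j x ->
  D (lframe j) x (cplxJ v) = 'i *: D (lframe j) x v.
Proof.
move=> jx.
have := hD.2 (ldom j) (lframe j) (ldom_open j) (lframe_smooth h j) x v jx.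
rewrite dbarL_frame // /part01 => /eqP.
rewrite scaler_eq0 invr_eq0 pnatr_eq0 /= addrC addr_eq0 => /eqP e.
have : 'i *: ('i *: D (lframe j) x (cplxJ v)) = 'i *: (- D (lframe j) x v).
  by rewrite e.
rewrite scalerA -expr2 sqrCi scaleN1r scalerN.
by move/oppr_inj.
Qed.

(** By [nabla_frameJ], ['i] leaves the inner derivative as a constant factor, which [D] respects. In
    its first argument, [cov2] is only shown to be real linear. *)
Lemma cov2J u w x : U x -> cov2 u ('i *: w) x = 'i * cov2 u w x.
Proof.
move=> Ux; have [jx _] := Ux; rewrite /cov2.
have E y : U y -> cov ('i *: w) y = 'i *: cov w y.
  by move=> [jy _]; rewrite /cov coordvecZ nabla_frameJ.
rewrite (nabla_local D oU (@cov_smooth ('i *: w)) E _ Ux).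
by rewrite (nablaZ _ _ oU (@cov_smooth w) Ux) lcoefZ.
Qed.

Lemma curvatureE u v x : U x ->
  F x (coordvec i u x) (coordvec i v x) = cov2 u v x - cov2 v u x.
Proof.
move=> [jx ix].
have := hF (ldom_open j) (lframe_smooth h j) u v jx ix.
move=> /(congr1 (@lcoef _ _ _ L j x)); rewrite lframeK // => <-.
by rewrite /ext_connection lcoefB.
Qed.

Lemma covE u x : ldom j x -> cov u x = conn_form u x *: lframe j x.
Proof. by move=> jx; rewrite /conn_form lcoefK. Qed.

(** Leibniz rule for the product of theta(v) with the frame. *)
Lemma cov2E u v x : U x -> cov2 u v x =
  rderive u (conn_form v \o minv i) (mchart i x) + conn_form v x * conn_form u x.
Proof.
move=> Ux; have [jx ix] := Ux; rewrite /cov2.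
have E y : U y -> cov v y = conn_form v y *: lframe j y.
  by move=> [jy _]; exact: covE.
have Ce : smooth_section U (lframe j).
  by move=> k; apply: smooth_on_sub (@lframe_smooth _ _ _ L h j k) => y [[? _] ?]; split.
rewrite (nabla_local D oU (@cov_smooth v) E _ Ux).
rewrite (nabla_leibniz D oU (@conn_form_smooth v) Ce _ Ux).
rewrite (dfun_coordvec _ oU (@conn_form_smooth v) Ux ix).
by rewrite lcoefD // lframeK // lcoefZ.
Qed.

(** The products of values of theta commute and cancel, which leaves F = d theta. *)
Lemma curvature_local u v x : U x ->
  F x (coordvec i u x) (coordvec i v x) =
  rderive u (conn_form v \o minv i) (mchart i x)
  - rderive v (conn_form u \o minv i) (mchart i x).
Proof. by move=> Ux; rewrite curvatureE // !cov2E //; ring. Qed.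

(* The (0,2)-part of the curvature vanishes. *)
Lemma curvature02 u v x : U x ->
  F x (coordvec i u x) (coordvec i v x)
  - F x (coordvec i ('i *: u) x) (coordvec i ('i *: v) x)
  + 'i * (F x (coordvec i ('i *: u) x) (coordvec i v x)
          + F x (coordvec i u x) (coordvec i ('i *: v) x)) = 0.
Proof.
move=> Ux; rewrite !curvatureE // !(cov2J _ _ Ux).
have ii : ('i : Cx R) * 'i = -1 by rewrite -expr2 sqrCi.
set a := cov2 u v x; set b := cov2 v u x.
set c := cov2 ('i *: u) v x; set d := cov2 ('i *: v) u x.
transitivity ((a - b) + 'i * 'i * (a - b)); first by ring.
by rewrite ii; ring.
Qed.

Lemma curvature_imaginary u v x : U x ->
  (F x (coordvec i u x) (coordvec i v x))^*
  = - F x (coordvec i u x) (coordvec i v x).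
Proof.
move=> Ux; have [jx ix] := Ux.
pose H y := h y (lframe j y) (lframe j y).
pose P w y := h y (cov w y) (lframe j y) + h y (lframe j y) (cov w y).
have Ce : smooth_section U (lframe j).
  by move=> k; apply: smooth_on_sub (@lframe_smooth _ _ _ L h j k) => y [[? _] ?]; split.
have CH : smooth_on U H.
  by apply: smooth_on_sub (hmet_smooth h j) => y [].
have Cl w : smooth_on U (fun y => h y (cov w y) (lframe j y)).
  apply: (smooth_on_eq (f := fun y => conn_form w y * H y)) => //.
    by move=> y [jy _]; rewrite covE // hmetZ.
  by apply: smooth_onM => //; exact: conn_form_smooth.
have Cr w : smooth_on U (fun y => h y (lframe j y) (cov w y)).
  apply: (smooth_on_eq (f := fun y => (h y (cov w y) (lframe j y))^*)) => //.
    by move=> y _; rewrite -hmet_conj.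
  exact: smooth_on_conj.
have CP w : smooth_on U (P w) by exact: smooth_onD.
have PE w y : U y -> P w y = rderive w (H \o minv i) (mchart i y).
  move=> Uy; have [jy iy] := Uy.
  by rewrite -(dfun_coordvec w oU CH Uy iy) (hD.1 U _ _ oU Ce Ce y _ Uy).
(* Metric compatibility used twice: once inside [P b], once on each of its two terms. *)
have E a b : rderive a (rderive b (H \o minv i)) (mchart i x) =
    h x (D (cov b) x (coordvec i a x)) (lframe j x)
    + h x (cov b x) (cov a x)
    + (h x (cov a x) (cov b x)
      + h x (lframe j x) (D (cov b) x (coordvec i a x))).
  rewrite -(hD.1 U _ _ oU (@cov_smooth b) Ce x _ Ux).
  rewrite -(hD.1 U _ _ oU Ce (@cov_smooth b) x _ Ux).
  rewrite -(dfunD _ (Cl b) (Cr b) Ux) (dfun_coordvec _ oU (CP b) Ux ix).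
  have Az : (mchart i @` (U `&` mdom i)) (mchart i x) by exists x.
  have oA := open_chart_image (i := i) oU.
  apply: is_rd_rderive; apply: is_rd_near (Ck_is_rd a (CP b i 1%N) Az).
  apply: filterS (open_nbhs_nbhs (conj oA Az)).
  by move=> _ [y [Uy iy] <-] /=; rewrite mchartK // PE.
have := rderiveC u v (open_chart_image (i := i) oU) (CH i).
have Az : (mchart i @` (U `&` mdom i)) (mchart i x) by exists x.
move=> /(_ _ Az); rewrite !E => S.
have FE : F x (coordvec i u x) (coordvec i v x) *: lframe j x =
    D (cov v) x (coordvec i u x) - D (cov u) x (coordvec i v x).
  by rewrite -(hF (ldom_open j) (lframe_smooth h j) u v jx ix).
set f := F x _ _ in FE *.
have : h x (f *: lframe j x) (lframe j x) + h x (lframe j x) (f *: lframe j x) = 0.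
  rewrite FE hmetB hmetBr.
  move: S; set a1 := h x _ _; set a2 := h x _ _; set a3 := h x _ _.
  set a4 := h x _ _; set b1 := h x _ _; set b4 := h x _ _ => S.
  (* The mixed terms [a2] and [a3], products of two first covariant derivatives, occur in both
     second derivatives of [H] and cancel. *)
  have -> : a1 - b1 + (a4 - b4) = (a1 + a2 + (a3 + a4)) - (b1 + a3 + (a2 + b4)).
    by ring.
  by rewrite S subrr.
(* The sum is [f] plus its conjugate, times the nonzero squared norm of the frame. *)
rewrite hmetZ hmetZr -mulrDl => /eqP.
rewrite mulf_eq0 (negPf (hmet_frame_neq0 h jx)) orbF addrC addr_eq0.
by move/eqP.
Qed.

End ChernCurvature.

(** * From the curvature to the Kähler metric *)

Unset Implicit Arguments.
Set Strict Implicit.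
Set Printing Implicit Defensive.

Theorem mainTheorem7 (R : realType) (n : nat) (X : complexManifold R n)
    (L : holLineBundle X) (h : hermitianMetric L) (D : connection L)
    (F : tensor2 X)
    (hD : is_chern h D) (hF : is_curvature D F) (hpos : positive_form F) :
  let omega : tensor2 X := fun x u v => 'i * F x u v in
  exists g : real_tensor2 X,
    [/\ forall x (u v : tangent x), ofR (g x u v) = omega x u (cplxJ v),
        kahler g
      & forall x (u v : tangent x), fundamental_form g u v = omega x u v].
Proof.
have ii : ('i : Cx R) * 'i = -1 by rewrite -expr2 sqrCi.
have two0 : (2 : Cx R) != 0 by rewrite pnatr_eq0.
have JJ (x : X) (u : tangent x) : cplxJ (cplxJ u) = - u.
  by rewrite /cplxJ scalerA -expr2 sqrCi scaleN1r.
have local (x : X) : exists2 j : lindex L, ldom j x & forall i : mindex X, mdom i x ->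
    (ldom j `&` mdom i) x.
  by have [j jx] := lcover L x; exists j.
(* The pointwise properties of [F] are read off in [chart_at x], where coordinate vectors are
   arbitrary tangent vectors. *)
have FD (x : X) (u1 u2 v : tangent x) : F x (u1 + u2) v = F x u1 v + F x u2 v.
  have [j _ /(_ _ (mdom_chart_at x)) Ux] := local x.
  have E1 := curvatureE h hF (u1 + u2) v Ux.
  have E2 := curvatureE h hF u1 v Ux; have E3 := curvatureE h hF u2 v Ux.
  rewrite !coordvec_chart_at in E1 E2 E3.
  rewrite E1 E2 E3 (cov2Dl h D _ _ _ Ux) (cov2Dr h D _ _ _ Ux).
  by ring.
have FZ (x : X) (r : R) (u v : tangent x) : F x (ofR r *: u) v = ofR r * F x u v.
  have [j _ /(_ _ (mdom_chart_at x)) Ux] := local x.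
  have E1 := curvatureE h hF (ofR r *: u) v Ux.
  have E2 := curvatureE h hF u v Ux.
  rewrite !coordvec_chart_at in E1 E2.
  rewrite E1 E2 (cov2Zl h D _ _ _ Ux) (cov2Zr h D _ _ _ Ux).
  by ring.
have FN (x : X) (u v : tangent x) : F x v u = - F x u v.
  have [j _ /(_ _ (mdom_chart_at x)) Ux] := local x.
  have E1 := curvatureE h hF u v Ux; have E2 := curvatureE h hF v u Ux.
  rewrite !coordvec_chart_at in E1 E2.
  by rewrite E1 E2 opprB.
have Fconj (x : X) (u v : tangent x) : (F x u v)^* = - F x u v.
  have [j _ /(_ _ (mdom_chart_at x)) Ux] := local x.
  have E1 := curvature_imaginary hD hF u v Ux.
  by rewrite !coordvec_chart_at in E1.
have FJ (x : X) (u v : tangent x) : F x (cplxJ u) (cplxJ v) = F x u v.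
  have [j _ /(_ _ (mdom_chart_at x)) Ux] := local x.
  have E := curvature02 hD hF u v Ux.
  rewrite !coordvec_chart_at in E.
  (* As [F] is imaginary, conjugating [E] changes the sign of the difference but not of the term
     with factor ['i]. Subtracting the two equations isolates twice the difference. *)
  have E' : (F x u v - F x (cplxJ u) (cplxJ v)
    + 'i * (F x (cplxJ u) v + F x u (cplxJ v)))^* = 0 by rewrite E rmorph0.
  rewrite rmorphD rmorphB rmorphM rmorphD /= conjCi !Fconj in E'.
  have : 2 * (F x u v - F x (cplxJ u) (cplxJ v)) = 0.
    rewrite -[RHS](subrr (0 : Cx R)) -[X in _ = X - _]E -[X in _ = _ - X]E'.
    rewrite /cplxJ; ring.
  by move=> /eqP; rewrite mulf_eq0 (negPf two0) subr_eq0 => /eqP.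
(* Taking the real part loses nothing, since ['i * F] is real by [Fconj]. *)
pose g : real_tensor2 X := fun x u v => ReC ('i * F x u (cplxJ v)).
have gE (x : X) (u v : tangent x) : ofR (g x u v) = 'i * F x u (cplxJ v).
  apply: ReC_ImC_inj => //.
  have : ('i * F x u (cplxJ v))^* = 'i * F x u (cplxJ v).
    by rewrite rmorphM /= conjCi Fconj mulrNN.
  move=> /(congr1 (@ImC R)); rewrite ImC_conj ImC_ofR => e; lra.
have fE : fundamental_form g = fun x u v => 'i * F x u v.
  apply: functional_extensionality_dep => x.
  by apply/funext => u; apply/funext => v; rewrite /fundamental_form gE FJ.
exists g; split=> //; last by move=> x u v; rewrite fE.
have FNl (x : X) (u v : tangent x) : F x (- u) v = - F x u v.
  have N1 : ofR (-1 : R) = -1 by rewrite ofRN.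
  by rewrite -[- u]scaleN1r -N1 FZ N1 mulN1r.
split.
  split; last first.
    by move=> x u v; apply: (@complexI R); rewrite [LHS]gE [RHS]gE FJ.
  split=> [x u1 u2 v|x r u v|x u v|x u u0|i u v].
  - by rewrite /g FD mulrDr ReCD.
  - by rewrite /g FZ mulrCA (ReCM (ofR r)) ReC_ofR ImC_ofR mul0r subr0.
  - by rewrite /g (FN _ (cplxJ u) v) -(FJ _ (cplxJ u) v) JJ FNl opprK.
  (* The pair is u - sqrt(-1) J u, the (1,0)-vector attached to [u]. On it and its conjugate, [F]
     takes the value [2 * ('i * F x u (cplxJ u))], that is, twice [g x u u], so positivity of [F]
     becomes positivity of [g]. *)
  - have V0 : ((u, - cplxJ u) : tangentC x) <> 0 by case.
    have T : T10 ((u, - cplxJ u) : tangentC x).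
      by split; rewrite /= ?opprK // /cplxJ scalerN -/(cplxJ _) -/(cplxJ _) JJ opprK.
    have := hpos x _ T V0; rewrite /extC /conjT /= opprK.
    have Fuu w : F x w w = 0.
      have := FN x w w => /eqP; rewrite -addr_eq0 -mulr2n -mulr_natl mulf_eq0.
      by rewrite (negPf two0) => /eqP.
    rewrite !FNl !Fuu oppr0 subrr add0r (FN _ u (cplxJ u)) opprK.
    rewrite -mulr2n -mulr_natl mulrCA -gE.
    by rewrite pmulr_rgt0 ?ltr0n // -ofR0 ofR_lt.
  - apply: smooth_on_local => x ix; have [j jx _] := local x.
    exists (ldom j `&` mdom i); first by split.
    have oU : open (ldom j `&` mdom i).
      by apply: openI; [exact: ldom_open|exact: mdom_open].
    (* Since [coordvec] is complex linear, J of the field of [v] is the coordinate field of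
       ['i *: v]; the curvature on coordinate fields is a difference of smooth functions [cov2]. *)
    apply: (smooth_on_eq (f := fun y =>
      'i * (cov2 D j i u ('i *: v) y - cov2 D j i ('i *: v) u y))) => //.
      by move=> y Uy; rewrite gE -(curvatureE h hF _ _ Uy) coordvecZ.
    by apply: smooth_onZ => //; apply: smooth_onB => //; exact: (cov2_smooth h).
rewrite fE => i x u v w ix; have [j jx _] := local x.
have oU : open (ldom j `&` mdom i).
  by apply: openI; [exact: ldom_open|exact: mdom_open].
have oA := open_chart_image (i := i) oU.
have Az : (mchart i @` (ldom j `&` mdom i `&` mdom i)) (mchart i x) by exists x.
(* In the chart, the form is ['i] times d theta, so its differential involves only the second
   derivatives [q] of theta. *)
pose th a := conn_form D j i a \o minv i.
have Cth a : Cinfty (mchart i @` (ldom j `&` mdom i `&` mdom i)) (th a).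
  exact: (conn_form_smooth h D j i a i).
pose q a b c := rderive a (rderive b (th c)) (mchart i x).
have dF a b c : rderive a (fun z => 'i * F (minv i z)
    (coordvec i b (minv i z)) (coordvec i c (minv i z))) (mchart i x)
    = 'i * (q a b c - q a c b).
  have Cr d e := Ck_is_rd a (Ck_rderive d (Cth e 2%N)) Az.
  apply: is_rd_rderive; apply: is_rd_near (is_rdZ 'i (is_rdB (Cr b c) (Cr c b))).
  apply: filterS (open_nbhs_nbhs (conj oA Az)) => _ [y [Uy iy] <-].
  by rewrite mchartK // (curvature_local h hF _ _ Uy).
have qC a b c : q a b c = q b a c by exact: (rderiveC a b oA (Cth c) Az).
rewrite /dform2 !dF; move: q qC {dF} => q qC.
(* Here d(d theta) = 0: the six second derivatives cancel in pairs by symmetry. *)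
rewrite (qC v u w) (qC w u v) (qC w v u); ring.
Qed.
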